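(* If $\mathcal{H}_k$ is a truncated space (of some order $r\ge 2$), then the Shimorin-Aluthge kernel of $M_z$ is tridiagonal if and only if the standard Aluthge kernel of $M_z$ is tridiagonal.
   Context: $\mathbb{D}$ is the open unit disc, $\mathcal{O}(\mathbb{D})$ the space of analytic functions on $\mathbb{D}$. For a positive definite scalar kernel $k$ on $\mathbb{D}$, analytic in the first variable, $\mathcal{H}_k$ is its reproducing kernel Hilbert space, and the shift is $(M_zf)(w)=wf(w)$. An analytic tridiagonal space is such an $\mathcal{H}_k$ with $\mathbb{C}[z]\subseteq\mathcal{H}_k\subseteq\mathcal{O}(\mathbb{D})$ for which there are complex scalars $\{a_n\}_{n\ge 0}$, $\{b_n\}_{n\ge 0}$, $a_n\ne 0$ for all $n$, with $\sup_n|a_n/a_{n+1}|<\infty$, $\limsup_n|b_n/a_{n+1}|<1$, $\{|a_n/a_{n+1}|\}_{n\ge0}$ bounded away from zero, and such that $f_n(z)=(a_n+b_nz)z^n$, $n\ge 0$, form an orthonormal basis of $\mathcal{H}_k$ (so $k(z,w)=\sum_nf_n(z)\overline{f_n(w)}$). Then $M_z$ is bounded and left-invertible. It is a truncated space of order $r\ge 2$ if moreover $b_n=0$ for all $n\notin\{2,3,\dots,r\}$. For a bounded operator $T$: $|T|=(T^*T)^{1/2}$; $T=U|T|$ is the polar decomposition with $\ker U=\ker T$; $\tilde T=|T|^{1/2}U|T|^{1/2}$ is the Aluthge transform; if $T$ is left-invertible, $L_T=(T^*T)^{-1}T^*$ is the Shimorin left inverse. The Shimorin-Aluthge kernel of a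 left-invertible shift $M_z$ is the kernel $(z,w)\mapsto P_{\tilde{\mathcal{W}}}(I-zL)^{-1}(I-\bar wL^* )^{-1}|_{\tilde{\mathcal{W}}}$, where $\tilde{\mathcal{W}}=\ker\tilde M_z^*=|M_z|^{-1/2}\ker M_z^*$, $P_{\tilde{\mathcal{W}}}$ is the orthogonal projection onto $\tilde{\mathcal{W}}$, and $L=|M_z|^{1/2}\big((L_{M_z}|M_z|M_z)^{-1}L_{M_z}\big)|M_z|^{1/2}$ $(=L_{\tilde M_z})$, for $z,w$ in the disc $\{|z|<1/r(L)\}$ ($r(L)$ denoting the spectral radius of $L$). The standard Aluthge kernel of $M_z$ is $(z,w)\mapsto\langle|M_z|^{-1}k(\cdot,w),k(\cdot,z)\rangle_{\mathcal{H}_k}$, $z,w\in\mathbb{D}$. A kernel with expansion $\sum_{m,n\ge 0}C_{mn}z^m\bar w^n$ about the origin is tridiagonal if $C_{mn}=0$ whenever $|m-n|\ge 2$. *)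

(* Defs.v *)
From HB Require Import structures.
From mathcomp Require Import all_boot all_order all_algebra.
From mathcomp Require Import complex.
From mathcomp Require Import all_classical all_reals all_analysis.

Set Implicit Arguments.
Unset Strict Implicit.
Unset Printing Implicit Defensive.

Import Order.TTheory GRing.Theory Num.Theory.
Import numFieldNormedType.Exports.

Local Open Scope classical_set_scope.
Local Open Scope ring_scope.
Local Open Scope complex_scope.

(* Objects that exist and are unique for the operators of interest (adjoints,
   square roots, inverses, projections, ...) are selected with [xget] from the
   set of objects satisfying the defining property; the first argument of
   [xget] is a junk value used only when that set is empty. *)

(** Bounded operators on a complex Hilbert space *)

(* [inner] is linear in its first argument, conjugate-linear in the second. *)
Record hilbert (R : realType) := Hilbert {
  hilbert_space :> completeNormedModType R[i];
  inner : {dot hilbert_space for (@Num.conj R[i])};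
  norm_inner : forall f : hilbert_space, `|f| ^+ 2 = inner f f }.
Arguments inner {R h}.

Definition bounded_operator (R : realType) (H : hilbert R) (T : H -> H) :=
  linear T /\ continuous T.

Definition ker_op (R : realType) (H : hilbert R) (T : H -> H) : set H :=
  [set f | T f = 0].

Definition adjoint (R : realType) (H : hilbert R) (T : H -> H) : H -> H :=
  xget (fun=> 0) [set S : H -> H | bounded_operator S /\
    forall f g, inner (T f) g = inner f (S g)].

Definition bounded_inverse (R : realType) (H : hilbert R) (T S : H -> H) :=
  [/\ bounded_operator S, T \o S = id & S \o T = id].

Definition inverse_op (R : realType) (H : hilbert R) (T : H -> H) : H -> H :=
  xget (fun=> 0) [set S : H -> H | bounded_inverse T S].

(* In R[i], [0 <= c] means that c is real and nonnegative. *)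
Definition positive_op (R : realType) (H : hilbert R) (T : H -> H) :=
  bounded_operator T /\ forall f, 0 <= inner (T f) f.

Definition sqrt_op (R : realType) (H : hilbert R) (T : H -> H) : H -> H :=
  xget (fun=> 0) [set S : H -> H | positive_op S /\ S \o S = T].

Definition abs_op (R : realType) (H : hilbert R) (T : H -> H) : H -> H :=
  sqrt_op (adjoint T \o T).

Definition partial_isometry (R : realType) (H : hilbert R) (U : H -> H) :=
  bounded_operator U /\
  forall f, (forall g, ker_op U g -> inner f g = 0) -> `|U f| = `|f|.

Definition polar_factor (R : realType) (H : hilbert R) (T : H -> H) : H -> H :=
  xget (fun=> 0) [set U : H -> H |
    [/\ partial_isometry U, U \o abs_op T = T & ker_op U = ker_op T]].

Definition aluthge (R : realType) (H : hilbert R) (T : H -> H) : H -> H :=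
  sqrt_op (abs_op T) \o polar_factor T \o sqrt_op (abs_op T).

Definition shimorin_left_inverse (R : realType) (H : hilbert R) (T : H -> H) :
    H -> H :=
  inverse_op (adjoint T \o T) \o adjoint T.

Definition orthogonal_projection (R : realType) (H : hilbert R) (W : set H) :
    H -> H :=
  xget (fun=> 0) [set P : H -> H |
    forall f, W (P f) /\ forall g, W g -> inner (f - P f) g = 0].

Definition spectrum (R : realType) (H : hilbert R) (T : H -> H) : set R[i] :=
  [set l | ~ exists S : H -> H, bounded_inverse (fun f => l *: f - T f) S].

Definition spectral_radius (R : realType) (H : hilbert R) (T : H -> H) : R :=
  sup [set Normc.normc l | l in spectrum T].

(** Reproducing kernel Hilbert spaces on the unit disc *)

Definition disc (R : realType) : set R[i] := [set z | Normc.normc z < 1].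
Arguments disc {R}.

(* Functions on the disc are total functions of which only the values on the
   disc matter. *)
Definition analytic_on_disc (R : realType) (f : R[i] -> R[i]) :=
  forall z, disc z -> derivable (f : R[i]^o -> R[i]^o) z 1.

Definition positive_definite_kernel (R : realType) (k : R[i] -> R[i] -> R[i]) :=
  forall (n : nat) (z c : 'I_n -> R[i]), (forall i, disc (z i)) ->
    0 <= \sum_(i < n) \sum_(j < n) c i * Num.conj (c j) * k (z j) (z i).

(* An element f of the space is identified with the function [ev f] on the
   disc. *)
Record rkhs (R : realType) (k : R[i] -> R[i] -> R[i]) := RKHS {
  rkhs_hilbert :> hilbert R;
  ev : rkhs_hilbert -> R[i] -> R[i];
  ev_linear : forall z, disc z -> forall (c : R[i]) (f g : rkhs_hilbert),
    ev (c *: f + g) z = c * ev f z + ev g z;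
  ev_inj : forall f g, (forall z, disc z -> ev f z = ev g z) -> f = g;
  ev_reproducing : forall w, disc w -> exists kw,
    (forall z, disc z -> ev kw z = k z w) /\
    forall f, ev f w = inner f kw }.
Arguments ev {R k r}.

(* k(., w) as an element of the space *)
Definition kernel_vector (R : realType) (k : R[i] -> R[i] -> R[i])
    (H : rkhs k) (w : R[i]) : H :=
  xget 0 [set f : H | forall z, disc z -> ev f z = k z w].
Arguments kernel_vector {R k} H.

Definition shift_op (R : realType) (k : R[i] -> R[i] -> R[i]) (H : rkhs k) :
    H -> H :=
  fun f => xget 0 [set g : H | forall w, disc w -> ev g w = w * ev f w].
Arguments shift_op {R k} H.

Definition orthonormal_basis (R : realType) (H : hilbert R) (e : nat -> H) :=
  (forall m n, inner (e m) (e n) = (m == n)%:R) /\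
  forall f : H, (fun N => \sum_(n < N) inner f (e n) *: e n) @ \oo --> f.

(* The space is analytic tridiagonal with scalars a, b. *)
Definition analytic_tridiagonal (R : realType) (k : R[i] -> R[i] -> R[i])
    (H : rkhs k) (a b : nat -> R[i]) :=
  [/\ (forall p : {poly R[i]}, exists f : H,
         forall z, disc z -> ev f z = p.[z])
        /\ (forall f : H, analytic_on_disc (ev f)),
      forall n, a n != 0,
      (exists M : R, forall n, Normc.normc (a n / a n.+1) <= M)
        /\ (exists2 d : R, 0 < d & forall n, d <= Normc.normc (a n / a n.+1)),
      (limn_esup (fun n => (Normc.normc (b n / a n.+1))%:E) < 1)%E
    & exists2 e : nat -> H, orthonormal_basis e &
        forall n z, disc z -> ev (e n) z = (a n + b n * z) * z ^+ n].

Definition truncated_space (R : realType) (k : R[i] -> R[i] -> R[i])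
    (H : rkhs k) (r : nat) :=
  exists a b, analytic_tridiagonal H a b /\
    forall n, ~~ (2 <= n <= r)%N -> b n = 0.

(** Tridiagonal kernels *)

(* F(z, w) = sum_(m, n) c_mn z^m conj(w)^n, as an absolutely convergent double
   series, for z, w in Omega of modulus less than e. *)
Definition has_expansion (R : realType) (V : normedModType R[i])
    (Omega : set R[i]) (e : R) (F : R[i] -> R[i] -> V) (c : nat -> nat -> V) :=
  forall z w, Omega z -> Omega w ->
    Normc.normc z < e -> Normc.normc w < e ->
    (exists M : R[i], forall N,
      \sum_(m < N) \sum_(n < N) `|z ^+ m * Num.conj w ^+ n *: c m n| <= M) /\
    (fun N => \sum_(m < N) \sum_(n < N) (z ^+ m * Num.conj w ^+ n) *: c m n)
      @ \oo --> F z w.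

Definition tridiagonal_kernel (R : realType) (Omega : set R[i])
    (K : R[i] -> R[i] -> R[i]) :=
  exists (e : R) (c : nat -> nat -> R[i]),
    [/\ 0 < e,
        has_expansion Omega e (K : R[i] -> R[i] -> R[i]^o) c
      & forall m n, (m + 2 <= n)%N || (n + 2 <= m)%N -> c m n = 0].

(* Version for a kernel whose values are operators on the subspace W, given as
   functions on H of which only the restriction to W matters.  The expansion
   holds strongly, on a neighbourhood of the origin that does not depend on the
   vector; as the coefficients of a double power series are unique, each c m n
   is then a linear map on W when K takes linear values. *)
Definition tridiagonal_operator_kernel (R : realType) (H : hilbert R)
    (W : set H) (Omega : set R[i]) (K : R[i] -> R[i] -> H -> H) :=
  exists (e : R) (c : nat -> nat -> H -> H),
    [/\ 0 < e,
        forall f, W f ->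
          has_expansion Omega e (fun z w => K z w f) (fun m n => c m n f)
      & forall m n, (m + 2 <= n)%N || (n + 2 <= m)%N ->
          forall f, W f -> c m n f = 0].

(** The two Aluthge kernels of the shift *)

Definition aluthge_wandering_subspace (R : realType)
    (k : R[i] -> R[i] -> R[i]) (H : rkhs k) : set H :=
  ker_op (adjoint (aluthge (shift_op H))).
Arguments aluthge_wandering_subspace {R k} H.

Definition aluthge_left_inverse (R : realType)
    (k : R[i] -> R[i] -> R[i]) (H : rkhs k) : H -> H :=
  let M := shift_op H in
  let LM := shimorin_left_inverse M in
  sqrt_op (abs_op M) \o
    (inverse_op (LM \o abs_op M \o M) \o LM) \o sqrt_op (abs_op M).
Arguments aluthge_left_inverse {R k} H.

Definition shimorin_aluthge_domain (R : realType)
    (k : R[i] -> R[i] -> R[i]) (H : rkhs k) : set R[i] :=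
  [set z | Normc.normc z * spectral_radius (aluthge_left_inverse H) < 1].
Arguments shimorin_aluthge_domain {R k} H.

Definition shimorin_aluthge_kernel (R : realType)
    (k : R[i] -> R[i] -> R[i]) (H : rkhs k) (z w : R[i]) : H -> H :=
  let L := aluthge_left_inverse H in
  orthogonal_projection (aluthge_wandering_subspace H) \o
    inverse_op (fun f => f - z *: L f) \o
    inverse_op (fun f => f - Num.conj w *: adjoint L f).
Arguments shimorin_aluthge_kernel {R k} H.

Definition standard_aluthge_kernel (R : realType)
    (k : R[i] -> R[i] -> R[i]) (H : rkhs k) (z w : R[i]) : R[i] :=
  inner (inverse_op (abs_op (shift_op H)) (kernel_vector H w))
        (kernel_vector H z).
Arguments standard_aluthge_kernel {R k} H.

(* Main.v *)
Require Import Defs.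
From HB Require Import structures.
From mathcomp Require Import all_boot all_order all_algebra.
From mathcomp Require Import complex ring.
From mathcomp Require Import all_classical all_reals all_analysis.

Set Implicit Arguments.
Unset Strict Implicit.
Unset Printing Implicit Defensive.

Import Order.TTheory GRing.Theory Num.Theory.
Import numFieldNormedType.Exports.

Local Open Scope classical_set_scope.
Local Open Scope ring_scope.
Local Open Scope complex_scope.

(** For a truncated space the two kernels are proportional near the origin, so
    their expansions have the same zero pattern.

    Write M for the shift, M' for its adjoint, T = |M|, S = |M|^(1/2), and let
    e0 = f_0.  As b_0 = b_1 = 0, e0 is a constant function and f_1 = a_1 z, so
    - ker M' is the line spanned by e0, and the Shimorin left inverse of M is
      the backward shift B f = (f - f(0)) / z;
    - M e0 is a multiple of f_1, which is orthogonal to M f_n for n >= 1; hence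
      e0 is an eigenvector of M' M, and so of T and S, with eigenvalues t^2, t
      and t^(1/2).
    Since B kills e0, the operator L of the Shimorin-Aluthge kernel collapses to
    S B S^-1, and the wandering subspace of the Aluthge transform is again the
    line spanned by e0.  The function w |-> w (B f)(w) is f - f(0); dually, with
    k_w the kernel vector and a the value of e0,
      conj w *: B' k_w = k_w - conj a *: e0.
    This gives (I - conj w L')^-1 e0 = (t^(1/2) / conj a) *: S^-1 k_w in closed
    form, and the compression of (I - z L)^-1 (I - conj w L')^-1 to the line of
    e0 is multiplication by
      (t / |a|^2) <S^-1 k_w, S^-1 k_z> = (t / |a|^2) <T^-1 k_w, k_z>,
    a constant multiple of the standard Aluthge kernel.  This is
    [aluthge_kernelE], stated for any M and B related as above;
    [truncated_backward_shift] shows that a truncated space is such a case.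

    The remaining work is the existence of the objects involved.  Adjoints and
    inverses are all explicit: M and B act on the basis f_n as a weighted shift
    up to finitely many vectors ([operator_on_basis]), (M' M)^-1 = B B', and
    T^-1 = T B B'.  Square roots of positive invertible operators come from a
    fixed point iteration ([sqrt_exists]); inverses of I - z L for small z come
    from the Neumann series ([neumann_inverse]). *)

(** * Inner products *)

Section Inner.
Variables (R : realType) (H : hilbert R).
Implicit Types (f g h : H) (c : R[i]).

Lemma innerDl f g h : inner (f + g) h = inner f h + inner g h.
Proof. exact: linearDl. Qed.

Lemma innerDr f g h : inner f (g + h) = inner f g + inner f h.
Proof. exact: raddfD. Qed.

Lemma innerBl f g h : inner (f - g) h = inner f h - inner g h.
Proof. exact: linearBl. Qed.

Lemma innerBr f g h : inner f (g - h) = inner f g - inner f h.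
Proof. exact: raddfB. Qed.

Lemma innerZl c f g : inner (c *: f) g = c * inner f g.
Proof. exact: linearZl_LR. Qed.

Lemma innerZr c f g : inner f (c *: g) = Num.conj c * inner f g.
Proof. exact: linearZr_LR. Qed.

Lemma inner0l f : inner 0 f = 0.
Proof. exact: linear0l. Qed.

Lemma inner0r f : inner f 0 = 0.
Proof. exact: raddf0. Qed.

Lemma innerC f g : inner f g = Num.conj (inner g f).
Proof. by rewrite hermC expr0 mul1r. Qed.

Lemma inner_suml (I : Type) (s : seq I) (P : pred I) (F : I -> H) g :
  inner (\sum_(i <- s | P i) F i) g = \sum_(i <- s | P i) inner (F i) g.
Proof. exact: linear_sumlz. Qed.

Lemma inner_sumr (I : Type) (s : seq I) (P : pred I) (F : I -> H) g :
  inner g (\sum_(i <- s | P i) F i) = \sum_(i <- s | P i) inner g (F i).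
Proof. exact: raddf_sum. Qed.

Lemma inner_ge0 f : 0 <= inner f f.
Proof. by rewrite -norm_inner exprn_ge0. Qed.

Lemma inner_eq0 f : inner f f = 0 -> f = 0.
Proof.
by rewrite -norm_inner => /eqP; rewrite expf_eq0/= normr_eq0 => /eqP.
Qed.

Lemma inner_extl f g : (forall h, inner f h = inner g h) -> f = g.
Proof.
move=> fg; apply/eqP; rewrite -subr_eq0; apply/eqP/inner_eq0.
by rewrite innerBl fg subrr.
Qed.

Lemma inner_extr f g : (forall h, inner h f = inner h g) -> f = g.
Proof. by move=> fg; apply: inner_extl => h; rewrite innerC fg -innerC. Qed.

Lemma cauchy_schwarz f g : `|inner f g| <= `|f| * `|g|.
Proof.
have [->|g0] := eqVneq g 0; first by rewrite inner0r !normr0 mulr0.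
have ng : 0 < `|g| by rewrite normr_gt0.
rewrite -(@ler_pXn2r _ 2%N) ?nnegrE ?mulr_ge0// exprMn.
set c := inner f g / `|g| ^+ 2.
have : 0 <= inner (f - c *: g) (f - c *: g) by exact: inner_ge0.
have -> : inner (f - c *: g) (f - c *: g) =
    `|f| ^+ 2 - `|inner f g| ^+ 2 / `|g| ^+ 2.
  rewrite !(innerBl, innerBr, innerZl, innerZr) -!norm_inner (innerC g f).
  rewrite normCK rmorphM fmorphV/= (geC0_conj (exprn_ge0 2 (normr_ge0 g))).
  rewrite /c; set a := inner f g; set b := Num.conj a.
  set n := `|g| ^+ 2.
  have n0 : n != 0 by rewrite expf_eq0/= normr_eq0.
  by field.
by rewrite subr_ge0 ler_pdivrMr// exprn_gt0.
Qed.

End Inner.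

(** * Limits *)

Lemma linear_bound_continuous (K : numFieldType) (V W : normedModType K)
    (phi : V -> W) (c : K) : linear phi -> 0 < c ->
  (forall x, `|phi x| <= c * `|x|) -> continuous phi.
Proof.
move=> lphi c0 phic; pose phi' : {linear V -> W} :=
  HB.pack phi (GRing.isLinear.Build _ _ _ _ phi lphi).
apply: (@bounded_linear_continuous _ _ _ phi').
apply/linear_boundedP; near=> r => x; apply: le_trans (phic x) _.
rewrite ler_wpM2r//; near: r; apply: nbhs_pinfty_ge; exact: gtr0_real.
Unshelve. all: by end_near. Qed.

(** Transfers the Cauchy property; it serves where the increments of [x] are
    controlled by those of a sequence already known to converge. *)
Lemma cvgn_dominated (K : numFieldType) (V : completeNormedModType K)
    (W : normedModType K) (x : nat -> V) (y : nat -> W) :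
  cvgn y -> (forall p q, `|x q - x p| <= `|y q - y p|) -> cvgn x.
Proof.
move=> /cvg_cauchy/cauchy_ballP cy xy; apply/cauchy_cvgP/cauchy_ballP => e e0.
have [/= [A B] [yA yB] AB] := cy e e0.
exists (x @` (y @^-1` A), x @` (y @^-1` B)).
  split; rewrite /nbhs/=.
    by apply: (filterS _ (yA : nbhs \oo (y @^-1` A))) => n /= yn; exists n.
  by apply: (filterS _ (yB : nbhs \oo (y @^-1` B))) => n /= yn; exists n.
move=> _ [/= [p Ap <-] [q Bq <-]]; have := AB (y p, y q) (conj Ap Bq).
rewrite -!ball_normE/=; exact: le_lt_trans (xy _ _).
Qed.

Section Limits.
Variables (R : realType) (H : hilbert R).
Implicit Types (u v : nat -> H) (f g h : H).

Lemma cvg_dist_lt u f (e : R[i]) : u @ \oo --> f -> 0 < e ->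
  exists N, forall n, (N <= n)%N -> `|f - u n| < e.
Proof. by move=> /cvgrPdist_lt uf /uf[N _ fu]; exists N. Qed.

Lemma lim_norm_le u f (c : R[i]) :
  u @ \oo --> f -> (forall n, `|u n| <= c) -> `|f| <= c.
Proof.
move=> uf uc; apply/ler_addgt0Pr => e e0.
have [N /(_ N (leqnn _))/ltW fu] := cvg_dist_lt uf e0.
by rewrite -(subrK (u N) f) addrC (le_trans (ler_normD _ _))// lerD.
Qed.

Lemma cvg_dominated u f (v : nat -> H) g (K : R[i]) : 0 < K ->
  v @ \oo --> g -> (forall n, `|f - u n| <= K * `|g - v n|) -> u @ \oo --> f.
Proof.
move=> K0 vg le_uv; apply/cvgrPdist_lt => e e0.
have [N Nvg] := cvg_dist_lt vg (divr_gt0 e0 K0).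
exists N => // n Nn /=; apply: le_lt_trans (le_uv n) _.
by rewrite mulrC -ltr_pdivlMr//; exact: Nvg.
Qed.

(** Adjointness passes to strong limits: Cauchy-Schwarz makes both sides
    continuous in the varying argument. *)
Lemma cvg_inner_uniq u v f g h h' : u @ \oo --> f -> v @ \oo --> g ->
  (forall n, inner (u n) h = inner h' (v n)) -> inner f h = inner h' g.
Proof.
move=> uf vg uv; apply/eqP; rewrite -subr_eq0 -normr_le0.
apply/ler_addgt0Pr => e e0; rewrite add0r.
have d0 : 0 < e / (`|h| + `|h'| + 1) by rewrite divr_gt0// ltr_wpDl// addr_ge0.
have [N Nu] := cvg_dist_lt uf d0.
have [N' Nv] := cvg_dist_lt vg d0.
pose n := maxn N N'.
have -> : inner f h - inner h' g = inner (f - u n) h - inner h' (g - v n).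
  by rewrite innerBl innerBr uv; ring.
apply: le_trans (ler_normB _ _) _.
apply: le_trans (lerD (cauchy_schwarz _ _) (cauchy_schwarz _ _)) _.
apply: (@le_trans _ _ (e / (`|h| + `|h'| + 1) * (`|h| + `|h'|))).
  rewrite mulrDr; apply: lerD; first by rewrite ler_wpM2r// ltW// Nu// leq_maxl.
  by rewrite mulrC ler_wpM2r// ltW// Nv// leq_maxr.
rewrite mulrAC ler_pdivrMr ?ltr_wpDl ?addr_ge0//.
by rewrite ler_pM2l// lerDl.
Qed.

End Limits.

(** * Bounded operators and adjoints *)

Section Operators.
Variables (R : realType) (H : hilbert R).
Implicit Types (S T : H -> H) (f g : H).

Lemma linear_opP T : linear T ->
  [/\ forall f g, T (f + g) = T f + T g, forall f g, T (f - g) = T f - T g,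
      forall c f, T (c *: f) = c *: T f & T 0 = 0].
Proof.
move=> hT; pose T' : {linear H -> H} :=
  HB.pack T (GRing.isLinear.Build _ _ _ _ T hT).
by split; [exact: (linearD T')|exact: (linearB T')|exact: (linearZ_LR T')|
  exact: (linear0 T')].
Qed.

Lemma bounded_operatorP T : bounded_operator T <->
  linear T /\ exists2 K, 0 < K & forall f, `|T f| <= K * `|f|.
Proof.
split=> -[hT cT]; split=> //; last first.
  by move: cT => [K K0 TK]; exact: linear_bound_continuous TK.
pose T' : {linear H -> H} := HB.pack T (GRing.isLinear.Build _ _ _ _ T hT).
have /linear_boundedP/pinfty_ex_gt0 [K K0 TK] :=
  (linear_bounded_continuous T').2 cT.
by exists K.
Qed.

Lemma bounded_operator_comp S T :
  bounded_operator S -> bounded_operator T -> bounded_operator (S \o T).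
Proof.
move=> [lS cS] [lT cT]; split; first by move=> c f g /=; rewrite lT lS.
by move=> x; apply: continuous_comp; [exact: cT|exact: cS].
Qed.

Lemma inverse_opE T S :
  bounded_inverse T S -> inverse_op T = S.
Proof.
move=> TS; have [_ TS1 S1T] := TS.
have : bounded_inverse T (inverse_op T) by exact: (@xgetI _ _ _ S).
case=> _ TX XT; apply/funext => f.
have := congr1 (fun F => F (S f)) XT; have := congr1 (fun F => F f) TS1.
by rewrite /= => ->.
Qed.

(** The adjoint is carried along with the operator, as each one that occurs can
    be written down explicitly. *)
Definition adjoint_pair T S := [/\ bounded_operator T, bounded_operator S &
  forall f g, inner (T f) g = inner f (S g)].

(** The adjoint identity forces both maps to be linear, and a bound on one gives
    the same bound on the other through |S f|^2 = <T (S f), f>. *)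
Lemma adjoint_pair_intro T S (K : R[i]) : 0 < K ->
  (forall f, `|T f| <= K * `|f|) ->
  (forall f g, inner (T f) g = inner f (S g)) -> adjoint_pair T S.
Proof.
move=> K0 TK TS; split=> //; apply/bounded_operatorP; split.
- move=> c f g; apply: inner_extl => h.
  by rewrite !(TS, innerDl, innerZl).
- by exists K.
- move=> c f g; apply: inner_extr => h.
  by rewrite !(innerDr, innerZr) -!TS innerDr innerZr.
exists K => // f; have [->|Sf0] := eqVneq (S f) 0.
  by rewrite normr0 mulr_ge0// ltW.
rewrite -(@ler_pM2r _ `|S f|) ?normr_gt0//.
have -> : `|S f| * `|S f| = `|inner (T (S f)) f|.
  by rewrite TS -expr2 -norm_inner ger0_norm ?exprn_ge0.
apply: le_trans (cauchy_schwarz _ _) _.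
by rewrite mulrAC ler_wpM2r.
Qed.

Lemma adjoint_pair_sym T S : adjoint_pair T S -> adjoint_pair S T.
Proof.
by move=> [bT bS TS]; split=> // f g; rewrite innerC -TS -innerC.
Qed.

Lemma adjoint_pair_comp T1 S1 T2 S2 :
  adjoint_pair T1 S1 -> adjoint_pair T2 S2 ->
  adjoint_pair (T1 \o T2) (S2 \o S1).
Proof.
move=> [bT1 bS1 TS1] [bT2 bS2 TS2]; split; try exact: bounded_operator_comp.
by move=> f g /=; rewrite TS1 TS2.
Qed.

Lemma adjoint_pair_add T1 S1 T2 S2 :
  adjoint_pair T1 S1 -> adjoint_pair T2 S2 ->
  adjoint_pair (fun f => T1 f + T2 f) (fun f => S1 f + S2 f).
Proof.
move=> [/bounded_operatorP[_ [K1 K10 TK1]] _ TS1].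
move=> [/bounded_operatorP[_ [K2 K20 TK2]] _ TS2].
apply: (@adjoint_pair_intro _ _ (K1 + K2)); first exact: addr_gt0.
  by move=> f; rewrite mulrDl (le_trans (ler_normD _ _))// lerD.
by move=> f g; rewrite innerDl innerDr TS1 TS2.
Qed.

Lemma adjoint_pair0 : adjoint_pair (fun=> 0) (fun=> 0).
Proof.
apply: (@adjoint_pair_intro _ _ 1) => // f; first by rewrite normr0 mul1r.
by move=> g; rewrite inner0l inner0r.
Qed.

Lemma adjoint_pair_rank1 u v :
  adjoint_pair (fun f => inner f u *: v) (fun f => inner f v *: u).
Proof.
apply: (@adjoint_pair_intro _ _ (`|u| * `|v| + 1)) => [|f|f g].
- by rewrite ltr_wpDl// mulr_ge0.
- rewrite normrZ mulrDl mul1r (@le_trans _ _ (`|u| * `|v| * `|f|))//.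
    by rewrite mulrAC ler_wpM2r// mulrC cauchy_schwarz.
  by rewrite lerDl.
- by rewrite innerZl innerZr -innerC mulrC.
Qed.

Lemma adjoint_pair_sum n (T S : nat -> H -> H) :
  (forall i, adjoint_pair (T i) (S i)) ->
  adjoint_pair (fun f => \sum_(i < n) T i f) (fun f => \sum_(i < n) S i f).
Proof.
move=> TS; elim: n => [|n IHn].
  have -> : (fun f => \sum_(i < 0) T i f) = fun=> 0.
    by apply/funext => f; rewrite big_ord0.
  have -> : (fun f => \sum_(i < 0) S i f) = fun=> 0.
    by apply/funext => f; rewrite big_ord0.
  exact: adjoint_pair0.
have -> : (fun f => \sum_(i < n.+1) T i f) =
    fun f => \sum_(i < n) T i f + T n f.
  by apply/funext => f; rewrite big_ord_recr.
have -> : (fun f => \sum_(i < n.+1) S i f) =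
    fun f => \sum_(i < n) S i f + S n f.
  by apply/funext => f; rewrite big_ord_recr.
exact: adjoint_pair_add.
Qed.

Lemma adjointE T S : adjoint_pair T S -> adjoint T = S.
Proof.
move=> [bT bS TS].
have [_ TX] : bounded_operator (adjoint T) /\
    forall f g, inner (T f) g = inner f (adjoint T g).
  exact: (@xgetI _ _ [set S : H -> H | bounded_operator S /\
    forall f g, inner (T f) g = inner f (S g)] S).
by apply/funext => f; apply: inner_extr => g; rewrite -TX TS.
Qed.

Lemma positive_adjoint_pair T : positive_op T -> adjoint_pair T T.
Proof.
move=> [bT T0]; split=> // f g.
have [TD _ TZ _] := linear_opP bT.1.
have re x : Num.conj (inner (T x) x) = inner (T x) x by apply: geC0_conj.
(* Polarisation: the quadratic form is real at f + g and at f + 'i *: g. *)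
have e1 := re (f + g); have e2 := re (f + 'i%R *: g).
have e3 := re f; have e4 := re g.
move: e1 e2; rewrite !(TD, TZ, innerDl, innerDr, innerZl, innerZr) (innerC f).
set a := inner (T f) g; set b := inner (T g) f.
rewrite !(rmorphD, rmorphM)/= e3 e4.
set a' := Num.conj a; set b' := Num.conj b; set x := inner (T f) f.
set y := inner (T g) g => e1 e2.
have i2 : 'i%R * 'i%R = -1 :> R[i] by rewrite -expr2 sqrCi.
have ci : Num.conj 'i%R = - 'i%R :> R[i] := conjCi _.
have e5 : a' + b' = a + b.
  have -> : a' + b' = x + b' + (a' + y) - x - y by ring.
  by rewrite e1; ring.
have e6 : a' - b' = b - a.
  move: e2; rewrite ci rmorphN/= ci => e2.
  have -> : a' - b' = - ('i%R * 'i%R) * (a' - b') by rewrite i2; ring.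
  have -> : - ('i%R * 'i%R) * (a' - b') = - 'i%R * (x + - 'i%R * b' +
    (- - 'i%R * a' + - 'i%R * (- - 'i%R * y)) - x - - 'i%R * (- - 'i%R * y)).
    by ring.
  by rewrite e2; transitivity ('i%R * 'i%R * (a - b)); [ring|rewrite i2; ring].
have -> : a = ((a + b) - (b - a)) / 2 by field.
by rewrite -e5 -e6; field.
Qed.

(** Expand the positive number <T g, g> at g = f - K^-1 T f. *)
Lemma positive_op_le T (K : R[i]) f : positive_op T -> 0 < K ->
  (forall f, `|T f| <= K * `|f|) -> `|T f| ^+ 2 <= K * inner (T f) f.
Proof.
move=> pT K0 TK; have [_ _ TT] := positive_adjoint_pair pT.
have [[lT _] T0] := pT; have [_ TB TZ _] := linear_opP lT.
have cK : Num.conj K^-1 = K^-1 by rewrite geC0_conj// invr_ge0 ltW.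
have e : inner (T (T f)) f = `|T f| ^+ 2 by rewrite TT norm_inner.
have h2 : inner (T (T f)) (T f) <= K * `|T f| ^+ 2.
  apply: le_trans (real_ler_norm _) _; first exact: ger0_real (T0 _).
  apply: le_trans (cauchy_schwarz _ _) _.
  by rewrite expr2 mulrA ler_wpM2r.
have := T0 (f - K^-1 *: T f).
rewrite !(TB, TZ, innerBl, innerBr, innerZl, innerZr) e -norm_inner cK => h.
have {}h : K^-1 * `|T f| ^+ 2 <= inner (T f) f.
  rewrite -subr_ge0; apply: le_trans h _.
  rewrite -subr_ge0.
  have -> : inner (T f) f - K^-1 * `|T f| ^+ 2 -
    (inner (T f) f - K^-1 * `|T f| ^+ 2 -
     (K^-1 * `|T f| ^+ 2 - K^-1 * (K^-1 * inner (T (T f)) (T f)))) =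
     K^-1 * K^-1 * (K * `|T f| ^+ 2 - inner (T (T f)) (T f)).
    by field; rewrite gt_eqF.
  by rewrite mulr_ge0 ?subr_ge0// mulr_ge0// invr_ge0 ltW.
by rewrite mulrC -ler_pdivrMr// mulrC.
Qed.

End Operators.

(** * Neumann series and square roots *)

Lemma cvg_complex_exp (R : realType) (q : R[i]) : 0 <= q -> q < 1 ->
  (fun n => q ^+ n : R[i]^o) @ \oo --> (0 : R[i]^o).
Proof.
move=> q0 q1; have [t qt] : exists t, q = t%:C.
  by apply/complex_realP/ger0_real.
rewrite qt ler0c in q0; rewrite qt ltcR in q1.
apply/cvgrPdist_lt => e e0; have [d ed] : exists d, e = d%:C.
  by apply/complex_realP/ger0_real/ltW.
rewrite ed ltcR in e0.
have /cvgrPdist_lt/(_ d e0)[N _ Nt] : (fun n => t ^+ n) @ \oo --> (0 : R).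
  by apply: cvg_expr; rewrite ger0_norm.
exists N => // n /Nt/=; rewrite !sub0r !normrN ger0_norm ?exprn_ge0// => nd.
by rewrite ger0_norm qt -?rmorphXn/= ?ler0c ?exprn_ge0// ed ltcR.
Qed.

Lemma cvgn_geometric (R : realType) (V : completeNormedModType R[i])
    (x : nat -> V) (q c : R[i]) : 0 <= q -> q < 1 ->
  (forall n, `|x n.+1 - x n| <= q ^+ n * c) -> cvgn x.
Proof.
move=> q0 q1 xq; pose y n : R[i]^o := (- (c / (1 - q))) *: (q ^+ n : R[i]^o).
have yE n : y n = - (c / (1 - q)) * q ^+ n by [].
have y_cvg : cvgn y.
  apply/cvg_ex; exists ((- (c / (1 - q))) *: (0 : R[i]^o)).
  by apply: cvgZl_tmp; exact: cvg_complex_exp.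
apply: (cvgn_dominated y_cvg).
have c0 : 0 <= c by have := le_trans (normr_ge0 _) (xq 0%N); rewrite mul1r.
have q10 : 1 - q != 0 by rewrite subr_eq0 eq_sym lt_eqF.
have le_pq p n : `|x (p + n)%N - x p| <= y (p + n)%N - y p.
  elim: n => [|n IHn]; first by rewrite addn0 !subrr normr0.
  rewrite addnS -(subrKA (x (p + n)%N)).
  apply: le_trans (ler_normD _ _) _.
  have -> : y (p + n).+1 - y p = q ^+ (p + n) * c + (y (p + n)%N - y p).
    by rewrite !yE exprS; field.
  by apply: lerD.
have le_pq' p n : (p <= n)%N -> `|x n - x p| <= `|y n - y p|.
  move=> /subnKC <-; rewrite [leRHS]ger0_norm ?le_pq//.
  exact: le_trans (normr_ge0 _) (le_pq _ _).
move=> p n; have [/le_pq'//|/ltnW/le_pq'] := leqP p n.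
by rewrite distrC (distrC (y n)).
Qed.

Section Neumann.
Variables (R : realType) (H : hilbert R).
Implicit Types (f g : H).

(** I - B is bounded below by 1 - q, hence injective with bounded inverse; each
    equation g - B g = f is solved by iterating g |-> f + B g.  Linearity of the
    inverse follows from injectivity. *)
Lemma neumann_inverse (B : H -> H) (q : R[i]) : linear B -> 0 <= q -> q < 1 ->
  (forall f, `|B f| <= q * `|f|) ->
  exists S, bounded_inverse (fun f => f - B f) S.
Proof.
move=> lB q0 q1 Bq; have [BD BB BZ B0] := linear_opP lB.
have q10 : 0 < 1 - q by rewrite subr_gt0.
have bnd g : (1 - q) * `|g| <= `|g - B g|.
  rewrite mulrBl mul1r lerBlDr -{1}(subrK (B g) g).
  by apply: le_trans (ler_normD _ _) _; rewrite lerD.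
have inj g g' : g - B g = g' - B g' -> g = g'.
  move=> gg'; apply/eqP; rewrite -subr_eq0 -normr_le0 -(pmulr_rle0 _ q10).
  apply: le_trans (bnd _) _; rewrite BB.
  have -> : g - g' - (B g - B g') = (g - B g) - (g' - B g').
    by rewrite !opprD addrACA.
  by rewrite gg' subrr normr0.
have sol f : exists g, g - B g = f.
  pose x n := iter n (fun g => f + B g) f.
  have /cvg_ex[/= g xg] : cvgn x.
    apply: (@cvgn_geometric _ _ _ q (q * `|f|)) => // n; elim: n => [|n IHn].
      by rewrite /x/= addrC addKr mul1r.
    have -> : x n.+2 - x n.+1 = B (x n.+1 - x n).
      by rewrite BB /x/= opprD addrACA subrr add0r.
    apply: le_trans (Bq _) _; rewrite exprS -mulrA; exact: ler_wpM2l.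
  have xg' : x @ \oo --> f + B g.
    rewrite -cvg_shiftS/=; apply: (@cvg_dominated _ _ _ _ x g 1) => // n.
    rewrite mul1r /x/= opprD addrACA subrr add0r -BB.
    by apply: le_trans (Bq _) _; rewrite ler_piMl// ltW.
  by exists g; rewrite {1}(norm_cvg_unique xg xg') addrK.
pose S f := projT1 (cid (sol f)).
have SE f : S f - B (S f) = f by rewrite /S; case: cid.
exists S; split; last 2 first.
- by apply/funext => f /=; rewrite SE.
- by apply/funext => f /=; apply: inj; rewrite SE.
apply/bounded_operatorP; split.
  move=> c f g; apply: inj; rewrite SE BD BZ opprD addrACA.
  by rewrite -scalerBr !SE.
exists (1 - q)^-1; first by rewrite invr_gt0.
by move=> f; rewrite mulrC ler_pdivlMr// mulrC -[leRHS](congr1 _ (SE f)).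
Qed.

End Neumann.

Section SquareRoot.
Variables (R : realType) (H : hilbert R).
Implicit Types (f g : H).

(** The iteration X |-> (B + X^2) / 2 keeps the ball of radius q, because
    (q + q^2) / 2 <= q, and contracts it by the factor q.  If B = I - A then
    I - X is a square root of A. *)
Lemma contraction_fixpoint (B : H -> H) (q : R[i]) :
  adjoint_pair B B -> 0 <= q -> q < 1 -> (forall f, `|B f| <= q * `|f|) ->
  exists X, [/\ adjoint_pair X X, forall f, `|X f| <= q * `|f| &
    forall f, X f *+ 2 = B f + X (X f)].
Proof.
move=> BB q0 q1 Bq.
pose F (X : H -> H) f := 2^-1 *: (B f + X (X f)).
have half : Num.conj 2^-1 = 2^-1 :> R[i] by rewrite geC0_conj// invr_ge0 ler0n.
have halfn : `|2^-1| = 2^-1 :> R[i] by rewrite ger0_norm// invr_ge0 ler0n.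
pose X n := iter n F (fun=> 0).
have XS n f : X n.+1 f = 2^-1 *: (B f + X n (X n f)) by [].
have Xq n f : `|X n f| <= q * `|f|.
  elim: n f => [|n IHn] f; first by rewrite normr0 mulr_ge0.
  rewrite XS normrZ halfn ler_pdivrMl ?ltr0n//.
  apply: le_trans (ler_normD _ _) _; rewrite mulr_natl mulr2n lerD//.
  apply: le_trans (IHn _) _; apply: ler_wpM2l => //; apply: le_trans (IHn _) _.
  by rewrite ler_piMl// ltW.
have Xadj n f g : inner (X n f) g = inner f (X n g).
  elim: n f g => [|n IHn] f g; first by rewrite inner0l inner0r.
  have [_ _ BE] := BB.
  by rewrite !XS innerZl innerZr half innerDl innerDr !IHn BE.
have q'0 : 0 < q + 1 by rewrite ltr_wpDl.
have Xpair n : adjoint_pair (X n) (X n).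
  apply: (@adjoint_pair_intro _ _ _ _ (q + 1)) => // f.
  by apply: le_trans (Xq _ _) _; rewrite ler_wpM2r// lerDl.
have Xlin n : forall f g, X n (f - g) = X n f - X n g.
  by have [[lX _] _ _] := Xpair n; have [] := linear_opP lX.
have Xcauchy n f : `|X n.+1 f - X n f| <= q ^+ n * (q * `|f|).
  elim: n f => [|n IHn] f; first by rewrite subr0 mul1r.
  have -> : X n.+2 f - X n.+1 f = 2^-1 *: (X n.+1 (X n.+1 f - X n f) +
      (X n.+1 (X n f) - X n (X n f))).
    rewrite (XS n.+1 f) [X in _ - X]XS -scalerBr Xlin subrKA.
    by rewrite opprD addrACA subrr add0r.
  rewrite normrZ halfn ler_pdivrMl ?ltr0n//.
  apply: le_trans (ler_normD _ _) _; rewrite mulr_natl mulr2n lerD//.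
    apply: le_trans (Xq _ _) _; rewrite exprS -mulrA; exact: ler_wpM2l.
  apply: le_trans (IHn _) _; rewrite exprSr -!mulrA ler_wpM2l ?exprn_ge0//.
  exact: ler_wpM2l.
have lim f : exists g, (X^~ f) @ \oo --> g.
  by apply/cvg_ex/(@cvgn_geometric _ _ _ q (q * `|f|)) => // n; exact: Xcauchy.
pose Y f := projT1 (cid (lim f)).
have YE f : (X^~ f) @ \oo --> Y f by rewrite /Y; case: cid.
have Yq f : `|Y f| <= q * `|f| by apply: lim_norm_le (YE f) _.
exists Y; split=> //.
  apply: (@adjoint_pair_intro _ _ _ _ (q + 1)) => // [f|f g].
    by apply: le_trans (Yq _) _; rewrite ler_wpM2r// lerDl.
  exact: cvg_inner_uniq (YE f) (YE g) _.
move=> f.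
have XX : (fun n => X n (X n f)) @ \oo --> Y (Y f).
  have to0 : (fun n => X n (Y f - X n f)) @ \oo --> (0 : H).
    apply: (cvg_dominated ltr01 (YE f)) => n.
    rewrite sub0r normrN mul1r; apply: le_trans (Xq _ _) _.
    by rewrite ler_piMl// ltW.
  have -> : (fun n => X n (X n f)) =
      (fun n => X n (Y f) - X n (Y f - X n f)).
    by apply/funext => n; rewrite Xlin opprB addrC subrK.
  by rewrite -(subr0 (Y (Y f))); exact: (cvgB (YE (Y f)) to0).
have XS' : (fun n => X n.+1 f) @ \oo --> 2^-1 *: (B f + Y (Y f)).
  by apply: cvgZl_tmp; exact: (cvgD (cvg_cst (B f)) XX).
have YfE : Y f = 2^-1 *: (B f + Y (Y f)).
  by have := YE f; rewrite -cvg_shiftS/= => Yf; exact: norm_cvg_unique Yf XS'.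
by rewrite {1}YfE -scaler_nat scalerA divff ?scale1r// pnatr_eq0.
Qed.

(** With K a bound of A and t = 1 / K, positivity makes I - t A a strict
    contraction: |f - t A f|^2 <= |f|^2 - t <A f, f> <= (1 - (t c)^2) |f|^2.
    The previous fixed point then gives the square root of t A. *)
Lemma sqrt_exists (A : H -> H) (c : R[i]) : positive_op A -> 0 < c ->
  (forall f, c * `|f| <= `|A f|) -> exists S, positive_op S /\ S \o S = A.
Proof.
move=> pA c0 Ac; have [bA A0] := pA; have AA := positive_adjoint_pair pA.
have [lA [K0 K00 AK0]] := (bounded_operatorP A).1 bA.
(* Adding c to the bound ensures c < K even on the zero space. *)
pose K := K0 + c; have K_gt0 : 0 < K by rewrite addr_gt0.
have AK f : `|A f| <= K * `|f|.
  by apply: le_trans (AK0 _) _; rewrite ler_wpM2r// lerDl ltW.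
pose t := K^-1; have t0 : 0 < t by rewrite invr_gt0.
have tC : Num.conj t = t by rewrite geC0_conj// ltW.
pose B f := f - t *: A f.
have tc1 : t * c < 1 by rewrite mulrC ltr_pdivrMr// mul1r ltrDr.
have tc0 : 0 < t * c by rewrite mulr_gt0.
have tc2 : (t * c) ^+ 2 < 1 by rewrite expr_lt1// ltW.
pose q := sqrtC (1 - (t * c) ^+ 2).
have q2 : q ^+ 2 = 1 - (t * c) ^+ 2 by rewrite sqrtCK.
have q0 : 0 <= q by rewrite sqrtC_ge0 subr_ge0 ltW.
have q1 : q < 1.
  by rewrite -(@expr_lt1 _ 2)// q2 ltrBlDr ltrDl exprn_gt0.
have Bq f : `|B f| <= q * `|f|.
  rewrite -(@ler_pXn2r _ 2%N) ?nnegrE ?mulr_ge0// exprMn q2 norm_inner.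
  rewrite /B innerBl !innerBr !innerZl !innerZr tC.
  have [_ _ AE] := AA; rewrite (AE f f) -(AE f f) -!norm_inner.
  have h := positive_op_le f pA K_gt0 AK.
  set x := inner (A f) f in h *; set y := `|A f| ^+ 2 in h *.
  have h1 : t * y <= x by rewrite mulrC ler_pdivrMr// mulrC.
  have h2 : t ^+ 2 * (c ^+ 2 * `|f| ^+ 2) <= t * x.
    rewrite expr2 -mulrA ler_pM2l//; apply: le_trans h1; rewrite ler_pM2l//.
    by rewrite -exprMn /y ler_pXn2r ?nnegrE ?mulr_ge0// ltW.
  have h3 : t * (t * y) <= t * x by rewrite ler_pM2l.
  rewrite mulrBl mul1r lerBrDr exprMn -mulrA.
  apply: (@le_trans _ _ (`|f| ^+ 2 - t * x - (t * x - t * (t * y)) + t * x)).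
    by rewrite lerD.
  by rewrite opprB addrA subrK -addrA gerDl addrC subr_le0.
have BB : adjoint_pair B B.
  apply: (@adjoint_pair_intro _ _ _ _ (q + 1)); first by rewrite ltr_wpDl.
    by move=> f; apply: le_trans (Bq _) _; rewrite ler_wpM2r// lerDl.
  move=> f g; rewrite /B innerBl innerBr innerZl innerZr tC.
  by have [_ _ ->] := AA.
have [X [XX Xq XE]] := contraction_fixpoint BB q0 q1 Bq.
have [[lX _] _ XA] := XX; have [XD XB XZ X0] := linear_opP lX.
pose s := sqrtC K; have s0 : 0 <= s by rewrite sqrtC_ge0 ltW.
have sC : Num.conj s = s by rewrite geC0_conj.
exists (fun f => s *: (f - X f)); split; last first.
  apply/funext => f /=; rewrite XZ -scalerBr scalerA -expr2 sqrtCK XB.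
  have -> : f - X f - (X f - X (X f)) = t *: A f.
    have -> : X f - X (X f) = B f - X f.
      rewrite -[X (X f)](addKr (B f)) -XE mulr2n opprD opprK addrCA opprD.
      by rewrite addNKr.
    by rewrite opprB subrKA /B opprB addrC subrK.
  by rewrite scalerA divff ?scale1r// gt_eqF.
split.
  have : adjoint_pair (fun f => s *: (f - X f)) (fun f => s *: (f - X f)).
    apply: (@adjoint_pair_intro _ _ _ _ (s * (1 + q) + 1)).
    - by rewrite ltr_wpDl// mulr_ge0// addr_ge0.
    - move=> f; rewrite normrZ ger0_norm// mulrDl mul1r.
      apply: (@le_trans _ _ (s * (1 + q) * `|f|)); last by rewrite lerDl.
      rewrite -mulrA ler_wpM2l// mulrDl mul1r.
      by apply: le_trans (ler_normB _ _) _; rewrite lerD.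
    - by move=> f g; rewrite innerZl innerZr sC innerBl innerBr XA.
  by case.
move=> f; rewrite innerZl mulr_ge0// innerBl -norm_inner subr_ge0.
have Xr : inner (X f) f \is Num.real by apply/CrealP; rewrite {2}XA -innerC.
apply: le_trans (real_ler_norm Xr) _; apply: le_trans (cauchy_schwarz _ _) _.
rewrite expr2 ler_wpM2r//; apply: le_trans (Xq _) _; by rewrite ler_piMl// ltW.
Qed.

End SquareRoot.

(** * Operators prescribed on an orthonormal basis *)

Section Orthonormal.
Variables (R : realType) (H : hilbert R).
Implicit Types (f g : H) (u v e : nat -> H).

Definition orthonormal_seq u := forall m n, inner (u m) (u n) = (m == n)%:R.

Lemma norm_orthonormal_sum u (c : nat -> R[i]) (s : seq nat) :
  orthonormal_seq u -> uniq s ->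
  `|\sum_(n <- s) c n *: u n| ^+ 2 = \sum_(n <- s) `|c n| ^+ 2.
Proof.
move=> uo; elim: s => [|m s IHs] /=; first by rewrite !big_nil normr0 expr0n.
move=> /andP[ms /IHs]; rewrite !big_cons; set x := \sum_(n <- s) _ => xE.
have mx : inner (u m) x = 0.
  rewrite inner_sumr big_seq big1// => n ns.
  rewrite innerZr uo (_ : m == n = false) ?mulr0//.
  by apply: contraNF ms => /eqP ->.
rewrite norm_inner innerDl !innerDr !innerZl !innerZr.
rewrite mx [inner x (u m)]innerC mx conjC0 uo eqxx -norm_inner xE normCK.
by rewrite !mulr0 addr0 add0r mulr1.
Qed.

(** Convergence is asked for, not completeness of the family, so that tails of a
    basis qualify. *)
Definition fourier_cvg u :=
  forall f, cvgn (fun N => \sum_(n < N) inner f (u n) *: u n : H).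

(** By Pythagoras the partial sums of w_n <f, u_n> v_n have increments at most K
    times those of the Fourier series of f along u.  The adjoint exchanges the
    roles of u and v and conjugates the weights. *)
Lemma diagonal_operator u v (w : nat -> R[i]) (K : R[i]) :
  orthonormal_seq u -> orthonormal_seq v -> fourier_cvg u -> fourier_cvg v ->
  (forall n, `|w n| <= K) ->
  exists V V', [/\ adjoint_pair V V', forall n, V (u n) = w n *: v n &
    forall f, (forall n, inner f (u n) = 0) -> V f = 0].
Proof.
move=> uo vo us vs wK.
have K0 : 0 <= K by exact: le_trans (normr_ge0 _) (wK 0%N).
have ex (u1 v1 : nat -> H) (w1 : nat -> R[i]) : orthonormal_seq u1 ->
    orthonormal_seq v1 -> fourier_cvg u1 -> (forall n, `|w1 n| <= K) ->
    forall f, cvgn (fun N => \sum_(n < N) (w1 n * inner f (u1 n)) *: v1 n : H)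
    /\ forall N, `|\sum_(n < N) (w1 n * inner f (u1 n)) *: v1 n| <= K * `|f|.
  move=> {}uo {}vo {}us {}wK f.
  have le_sum (s : seq nat) : uniq s ->
      `|\sum_(n <- s) (w1 n * inner f (u1 n)) *: v1 n| <=
      K * `|\sum_(n <- s) inner f (u1 n) *: u1 n|.
    move=> us'; rewrite -(@ler_pXn2r _ 2%N) ?nnegrE ?mulr_ge0// exprMn.
    rewrite !norm_orthonormal_sum// mulr_sumr; apply: ler_sum => n _.
    by rewrite normrM exprMn ler_wpM2r ?exprn_ge0// ler_pXn2r ?nnegrE.
  split.
    have /cvg_ex[/= g gE] := us f.
    pose y N : H := K *: (\sum_(n < N) inner f (u1 n) *: u1 n).
    have yc : cvgn y by apply/cvg_ex; exists (K *: g); apply: cvgZl_tmp.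
    apply: (cvgn_dominated yc).
    have le_pq p q : (p <= q)%N -> forall F : nat -> H,
        \sum_(n < q) F n - \sum_(n < p) F n = \sum_(n <- index_iota p q) F n.
      move=> pq F; rewrite -!(big_mkord xpredT) (big_cat_nat (leq0n p) pq)/=.
      by rewrite addrAC subrr add0r.
    have {}le_pq p q : (p <= q)%N ->
        `|\sum_(n < q) (w1 n * inner f (u1 n)) *: v1 n -
          \sum_(n < p) (w1 n * inner f (u1 n)) *: v1 n| <= `|y q - y p|.
      move=> pq; rewrite /y -scalerBr normrZ (ger0_norm K0).
      rewrite (le_pq p q pq (fun n => (w1 n * inner f (u1 n)) *: v1 n)).
      rewrite (le_pq p q pq (fun n => inner f (u1 n) *: u1 n)).
      by apply: le_sum; apply: iota_uniq.
    move=> p q; have [/le_pq//|/ltnW/le_pq] := leqP p q.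
    by rewrite distrC (distrC (y p)).
  move=> N; pose F n := (w1 n * inner f (u1 n)) *: v1 n.
  rewrite -[X in `|X|](big_mkord xpredT F).
  apply: le_trans (le_sum _ (iota_uniq _ _)) _; apply: ler_wpM2l => //.
  set x := \sum_(n <- _) _.
  have xf : inner f x = inner x x.
    rewrite -norm_inner norm_orthonormal_sum ?iota_uniq// inner_sumr.
    by apply: eq_bigr => n _; rewrite innerZr normCKC.
  have [->|x0] := eqVneq x 0; first by rewrite normr0.
  rewrite -(@ler_pM2r _ `|x|) ?normr_gt0// -expr2 norm_inner -xf.
  apply: le_trans (real_ler_norm _) (cauchy_schwarz _ _).
  by rewrite xf; exact: ger0_real (inner_ge0 _).
pose w' n := Num.conj (w n).
have w'K n : `|w' n| <= K by rewrite norm_conjC.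
have exV := ex u v w uo vo us wK; have exV' := ex v u w' vo uo vs w'K.
pose V f : H :=
  lim ((fun N => \sum_(n < N) (w n * inner f (u n)) *: v n : H) @ \oo).
pose V' f : H :=
  lim ((fun N => \sum_(n < N) (w' n * inner f (v n)) *: u n : H) @ \oo).
have VE f :
    (fun N => \sum_(n < N) (w n * inner f (u n)) *: v n : H) @ \oo --> V f.
  by have [] := exV f.
have V'E f :
    (fun N => \sum_(n < N) (w' n * inner f (v n)) *: u n : H) @ \oo --> V' f.
  by have [] := exV' f.
exists V, V'; split.
- apply: (@adjoint_pair_intro _ _ _ _ (K + 1)) => [|f|f g].
  + by rewrite ltr_wpDl.
  + apply: (@le_trans _ _ (K * `|f|)); last by rewrite ler_wpM2r// lerDl.
    by apply: lim_norm_le (VE f) _ => N; have [_] := exV f.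
  apply: cvg_inner_uniq (VE f) (V'E g) _ => N.
  rewrite inner_suml inner_sumr; apply: eq_bigr => n _.
  by rewrite innerZl innerZr rmorphM/= conjCK -innerC mulrAC.
- move=> n; apply: norm_cvg_unique (VE (u n)) _.
  apply: cvg_near_cst; exists n.+1 => // N /= nN.
  rewrite (bigD1 (Ordinal nN))//= big1 ?addr0 ?uo ?eqxx ?mulr1// => m mn.
  rewrite uo (_ : n == m = false) ?mulr0 ?scale0r//.
  by apply: contraNF mn => /eqP nm; apply/eqP/val_inj.
- move=> f fu; apply: norm_cvg_unique (VE f) _.
  apply: cvg_near_cst; exists 0%N => // N _.
  by rewrite big1// => n _; rewrite fu mulr0 scale0r.
Qed.

Lemma basis_ext e f g : orthonormal_basis e ->
  (forall n, inner (e n) f = inner (e n) g) -> f = g.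
Proof.
move=> [_ eb] fg; have fE := eb f; have gE := eb g.
apply: norm_cvg_unique fE _; apply: cvg_trans gE.
rewrite (_ : (fun N => \sum_(n < N) inner f (e n) *: e n) =
  (fun N => \sum_(n < N) inner g (e n) *: e n))//.
apply/funext => N; apply: eq_bigr => n _.
by rewrite [inner f _]innerC fg -innerC.
Qed.

Lemma fourier_cvg_tail e i : orthonormal_basis e ->
  fourier_cvg (fun n => e (i + n)%N).
Proof.
move=> [_ eb] f; apply/cvg_ex.
exists (f - \sum_(n < i) inner f (e n) *: e n : H).
have := eb f; rewrite -(cvg_shiftn i) => h.
rewrite (_ : (fun N => _) = fun N => \sum_(n < N + i) inner f (e n) *: e n -
    \sum_(n < i) inner f (e n) *: e n); last first.
  apply/funext => N.
  rewrite -!(big_mkord xpredT (fun n => inner f (e n) *: e n)).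
  rewrite (big_cat_nat (leq0n i) (leq_addl N i))/= addrAC subrr add0r.
  symmetry; rewrite -{1}(add0n i) big_addn addnK big_mkord.
  by apply: eq_bigr => n _; rewrite addnC.
by apply: cvgB => //; exact: cvg_cst.
Qed.

(** A weighted shift on a tail of the basis plus a finite rank operator.  This
    covers the shift and the backward shift of a truncated space, which have
    this form beyond the last nonzero b_n. *)
Lemma operator_on_basis e i j (w : nat -> R[i]) (K : R[i]) (p : nat -> H) :
  orthonormal_basis e -> (forall n, `|w n| <= K) ->
  exists T T', [/\ adjoint_pair T T', forall n, (n < i)%N -> T (e n) = p n &
    forall n, T (e (i + n)%N) = w n *: e (j + n)%N].
Proof.
move=> eb wK; have eo := eb.1.
have tail k : orthonormal_seq (fun n => e (k + n)%N).
  by move=> m n; rewrite eo eqn_add2l.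
have [V [V' [VV' Ve V0]]] := diagonal_operator (tail i) (tail j)
  (@fourier_cvg_tail e i eb) (@fourier_cvg_tail e j eb) wK.
have FF' := adjoint_pair_sum i (fun k => adjoint_pair_rank1 (e k) (p k)).
have TT' := adjoint_pair_add VV' FF'.
eexists; eexists; split; first exact: TT'.
- move=> n ni /=; rewrite V0 ?add0r.
    rewrite (bigD1 (Ordinal ni))//= big1 ?addr0 ?eo ?eqxx ?scale1r// => m mn.
    rewrite eo (_ : n == m = false) ?scale0r//.
    by apply: contraNF mn => /eqP nm; apply/eqP/val_inj.
  move=> m; rewrite eo (_ : n == _ = false)//; apply/negbTE.
  by rewrite neq_ltn (leq_trans ni)// leq_addr.
- move=> n /=; rewrite Ve big1 ?addr0// => m _.
  rewrite eo (_ : (i + n)%N == _ = false) ?scale0r//; apply/negbTE.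
  by rewrite neq_ltn orbC (leq_trans (ltn_ord m))// leq_addr.
Qed.

End Orthonormal.

(** * The Aluthge transform of a left-invertible operator *)

Section SqrtOp.
Variables (R : realType) (H : hilbert R).
Implicit Types (f g : H) (S T A : H -> H).

(** If A = S S is invertible, then S commutes with A, so S A' is a two-sided
    inverse of S. *)
Lemma sqrt_opP A A' : positive_op A -> bounded_inverse A A' ->
  [/\ positive_op (sqrt_op A), sqrt_op A \o sqrt_op A = A &
      bounded_inverse (sqrt_op A) (sqrt_op A \o A')].
Proof.
move=> pA [bA' AA' A'A].
have [lA' [K K0 A'K]] := (bounded_operatorP A').1 bA'.
have K10 : 0 < K^-1 by rewrite invr_gt0.
have Alow f : K^-1 * `|f| <= `|A f|.
  rewrite mulrC ler_pdivrMr// mulrC -{1}[f](congr1 (fun F => F f) A'A).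
  exact: A'K.
have [S0 S0P] := sqrt_exists pA K10 Alow.
have [pS SS] : positive_op (sqrt_op A) /\ sqrt_op A \o sqrt_op A = A.
  exact: (@xgetI _ _ [set S | positive_op S /\ S \o S = A] S0 S0P).
split=> //; set S := sqrt_op A in pS SS *.
have SSE f : S (S f) = A f by rewrite -[RHS](congr1 (fun F => F f) SS).
have AK f : A (A' f) = f by rewrite -[RHS](congr1 (fun F => F f) AA').
have A'E f : A' (A f) = f by rewrite -[RHS](congr1 (fun F => F f) A'A).
split; first exact: bounded_operator_comp pS.1 bA'.
  by apply/funext => f /=; rewrite SSE.
apply/funext => f /=; have AX : A (S (A' (S f))) = A f.
  by rewrite -SSE (SSE (A' _)) AK SSE.
by rewrite -[LHS]A'E AX A'E.
Qed.

(** (S - s) f lies in the eigenspace of S for -s, which is 0 as S is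
    positive. *)
Lemma positive_sqrt_eigen S A f (s : R[i]) : positive_op S -> S \o S = A ->
  0 < s -> A f = s ^+ 2 *: f -> S f = s *: f.
Proof.
move=> [[lS _] S0] SS s0 Af; have [SD SB SZ _] := linear_opP lS.
have Sv : S (S f - s *: f) = - s *: (S f - s *: f).
  rewrite SB SZ -[S (S f)]/((S \o S) f) SS Af expr2 -scalerA -scalerBr.
  by rewrite -opprB scalerN scaleNr.
apply/eqP; rewrite -subr_eq0; apply/eqP/inner_eq0/eqP; rewrite eq_le inner_ge0.
rewrite andbT -oppr_ge0 -(pmulr_rge0 _ s0) mulrN -mulNr -innerZl -Sv.
exact: S0.
Qed.

End SqrtOp.

Section AluthgeOfShift.
Variables (R : realType) (H : hilbert R).
(* M plays the part of the shift and B of the backward shift; t is the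
   eigenvalue of |M| at the unit vector e0 spanning the orthogonal complement of
   the range of M. *)
Variables (M M' B B' : H -> H) (e0 : H) (t : R[i]).
Hypotheses (MM' : adjoint_pair M M') (BB' : adjoint_pair B B').
Hypotheses (BM : forall f, B (M f) = f).
Hypotheses (MB : forall f, M (B f) = f - inner f e0 *: e0).
Hypotheses (e0_norm : inner e0 e0 = 1) (Be0 : B e0 = 0).
Hypotheses (t_gt0 : 0 < t) (M'M_e0 : M' (M e0) = t ^+ 2 *: e0).
Implicit Types (f g : H) (c z w : R[i]).

Let linM : linear M. Proof. by case: MM' => -[]. Qed.
Let linM' : linear M'. Proof. by case: MM' => _ []. Qed.
Let linB : linear B. Proof. by case: BB' => -[]. Qed.
Let linB' : linear B'. Proof. by case: BB' => _ []. Qed.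
Let ME f g : inner (M f) g = inner f (M' g). Proof. by case: MM'. Qed.
Let BE f g : inner (B f) g = inner f (B' g). Proof. by case: BB'. Qed.

Let e0_neq0 : e0 != 0.
Proof.
by apply: contra_eq_neq e0_norm => ->; rewrite inner0l eq_sym oner_neq0.
Qed.

Let ran_perp f : inner (M f) e0 = 0.
Proof.
have /eqP := MB (M f); rewrite BM -subr_eq0 opprB addrC subrK scaler_eq0.
by rewrite (negbTE e0_neq0) orbF => /eqP.
Qed.

Let M'e0 : M' e0 = 0.
Proof. by apply: inner_extr => f; rewrite -ME ran_perp inner0r. Qed.

Let M'B' f : M' (B' f) = f.
Proof. by apply: inner_extr => g; rewrite -ME -BE BM. Qed.

Let B'M' f : B' (M' f) = f - inner f e0 *: e0.
Proof.
apply: inner_extr => g; rewrite -BE -ME MB innerBl innerBr innerZl innerZr.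
by rewrite -innerC mulrC.
Qed.

(** M B and B' M' are both the projection off e0, which is killed by B and by
    M'. *)
Let bounded_inverse_M'M : bounded_inverse (M' \o M) (B \o B').
Proof.
have [_ BB BZ _] := linear_opP linB; have [_ MB' MZ' _] := linear_opP linM'.
split.
- by apply: bounded_operator_comp; case: BB'.
- by apply/funext => f /=; rewrite MB MB' MZ' M'e0 scaler0 subr0 M'B'.
- by apply/funext => f /=; rewrite B'M' BB BZ Be0 scaler0 subr0 BM.
Qed.

Let positive_M'M : positive_op (M' \o M).
Proof.
split; first by apply: bounded_operator_comp; case: MM'.
move=> f /=; have [_ _ MM] := adjoint_pair_sym MM'.
by rewrite MM inner_ge0.
Qed.

Lemma shimorin_left_inverseE : shimorin_left_inverse M = B.
Proof.
have [_ BB BZ _] := linear_opP linB.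
rewrite /shimorin_left_inverse (adjointE MM') (inverse_opE bounded_inverse_M'M).
by apply/funext => f /=; rewrite B'M' BB BZ Be0 scaler0 subr0.
Qed.

(* D and E are the inverses of T = |M| and of S = |M|^(1/2). *)
Let T := abs_op M.
Let S := sqrt_op T.
Let D : H -> H := T \o (B \o B').
Let E : H -> H := S \o D.
Let s := sqrtC t.

Let absE : T = sqrt_op (M' \o M).
Proof. by rewrite /T /abs_op (adjointE MM'). Qed.

Let absP : [/\ positive_op T, T \o T = M' \o M & bounded_inverse T D].
Proof. by rewrite /D absE; exact: sqrt_opP. Qed.

Let sqrtP : [/\ positive_op S, S \o S = T & bounded_inverse S E].
Proof. by have [pT _ TD] := absP; exact: sqrt_opP. Qed.

Let TT f : T (T f) = M' (M f).
Proof. by have [_ TT _] := absP; rewrite -[LHS]/((T \o T) f) TT. Qed.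
Let TD f : T (D f) = f.
Proof. by have [_ _ [_ TD _]] := absP; rewrite -[LHS]/((T \o D) f) TD. Qed.
Let DT f : D (T f) = f.
Proof. by have [_ _ [_ _ DT]] := absP; rewrite -[LHS]/((D \o T) f) DT. Qed.
Let SS f : S (S f) = T f.
Proof. by have [_ SS _] := sqrtP; rewrite -[LHS]/((S \o S) f) SS. Qed.
Let SE f : S (E f) = f.
Proof. by have [_ _ [_ SE _]] := sqrtP; rewrite -[LHS]/((S \o E) f) SE. Qed.
Let ES f : E (S f) = f.
Proof. by have [_ _ [_ _ ES]] := sqrtP; rewrite -[LHS]/((E \o S) f) ES. Qed.

Let Tpair : adjoint_pair T T.
Proof. by apply: positive_adjoint_pair; case: absP. Qed.
Let Spair : adjoint_pair S S.
Proof. by apply: positive_adjoint_pair; case: sqrtP. Qed.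
Let Dpair : adjoint_pair D D.
Proof.
have [_ _ [bD _ _]] := absP; have [_ _ TA] := Tpair; split=> // f g.
by rewrite -{1}[g]TD -TA TD.
Qed.
Let Epair : adjoint_pair E E.
Proof.
have [_ _ [bE _ _]] := sqrtP; have [_ _ SA] := Spair; split=> // f g.
by rewrite -{1}[g]SE -SA SE.
Qed.

Let DE f : D f = E (E f).
Proof. by rewrite -[RHS]DT -SS !SE. Qed.

Let Te0 : T e0 = t *: e0.
Proof. by have [pT TT' _] := absP; exact: (positive_sqrt_eigen pT TT'). Qed.

Let s_gt0 : 0 < s. Proof. by rewrite sqrtC_gt0. Qed.

Let Se0 : S e0 = s *: e0.
Proof.
have [pS SS' _] := sqrtP; apply: (positive_sqrt_eigen pS SS') => //.
by rewrite sqrtCK Te0.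
Qed.

Let linT : linear T. Proof. by case: Tpair => -[]. Qed.
Let linS : linear S. Proof. by case: Spair => -[]. Qed.
Let linD : linear D. Proof. by case: Dpair => -[]. Qed.
Let linE : linear E. Proof. by case: Epair => -[]. Qed.

Let Ee0 : E e0 = s^-1 *: e0.
Proof.
have [_ _ EZ _] := linear_opP linE.
by rewrite -{2}[e0]ES Se0 EZ scalerA mulVf ?scale1r// gt_eqF.
Qed.

Let De0 : D e0 = t^-1 *: e0.
Proof.
have [_ _ DZ _] := linear_opP linD.
by rewrite -{2}[e0]DT Te0 DZ scalerA mulVf ?scale1r// gt_eqF.
Qed.

Lemma inverse_absE : inverse_op (abs_op M) = D.
Proof. by apply: inverse_opE; case: absP. Qed.

(** M B differs from the identity by the projection onto e0; T and D preserve
    the line of e0, which B kills. *)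
Let bounded_inverse_BTM : bounded_inverse (B \o T \o M) (B \o D \o M).
Proof.
have [_ TB TZ _] := linear_opP linT; have [_ DB DZ _] := linear_opP linD.
have [_ BB BZ _] := linear_opP linB; split.
- apply: bounded_operator_comp; last by case: MM'.
  by apply: bounded_operator_comp; [case: BB'|case: Dpair].
- apply/funext => f /=; rewrite MB TB TZ TD Te0 BB !BZ Be0 !scaler0 subr0.
  exact: BM.
- apply/funext => f /=; rewrite MB DB DZ DT De0 BB !BZ Be0 !scaler0 subr0.
  exact: BM.
Qed.

Let L : H -> H :=
  S \o (inverse_op (shimorin_left_inverse M \o T \o M) \o
    shimorin_left_inverse M) \o S.

(** L = S B S^-1: since B D e0 = 0, the inverse of B T M composed with B is
    B D M B = B D. *)
Let LE f : L f = S (B (E f)).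
Proof.
have [_ DB DZ _] := linear_opP linD; have [_ BB BZ _] := linear_opP linB.
rewrite /L shimorin_left_inverseE (inverse_opE bounded_inverse_BTM) /=.
rewrite MB DB DZ De0 BB !BZ Be0 !scaler0 subr0.
by rewrite DE ES.
Qed.

Let Lpair : adjoint_pair L (E \o (B' \o S)).
Proof.
have -> : L = S \o B \o E by apply/funext.
apply: adjoint_pair_comp; last exact: Epair.
by apply: adjoint_pair_comp; first exact: Spair.
Qed.

(** T being invertible, the factorisation M = U T leaves no choice for U. *)
Let polar_factorE : polar_factor M = M \o D.
Proof.
have [_ _ _ T0] := linear_opP linT; have [_ _ _ D0] := linear_opP linD.
have [_ _ _ M0] := linear_opP linM; have [_ _ _ B0] := linear_opP linB.
have [_ UT _] : [/\ partial_isometry (polar_factor M),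
    polar_factor M \o abs_op M = M & ker_op (polar_factor M) = ker_op M].
  apply: (@xgetI _ _ [set U | [/\ partial_isometry U, U \o abs_op M = M &
    ker_op U = ker_op M]] (M \o D)); split.
  - split; first by apply: bounded_operator_comp; [case: MM'|case: Dpair].
    move=> f _ /=; apply/eqP; rewrite -(@eqrXn2 _ 2%N)//.
    rewrite !norm_inner ME -TT TD -[X in _ == inner _ X]TD.
    by case: Tpair => _ _ <-; rewrite TD.
  - by apply/funext => f /=; rewrite DT.
  - apply/seteqP; split=> f; rewrite /ker_op/= => Mf.
      by rewrite -[f]TD -[D f]BM Mf B0 T0 M0.
    by rewrite -[f]BM Mf B0 D0 M0.
apply/funext => f; rewrite -[f in LHS]TD.
by rewrite -[LHS]/((polar_factor M \o abs_op M) (D f)) UT.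
Qed.

(** The Aluthge transform is S M D S and its adjoint S D M' S, whose kernel is
    S^-1 (ker M'); S preserves the line ker M' of e0. *)
Lemma aluthge_wanderingE :
  ker_op (adjoint (aluthge M)) = [set f | exists c, f = c *: e0].
Proof.
have [_ _ SZ S0] := linear_opP linS; have [_ _ EZ E0] := linear_opP linE.
have [_ _ DZ D0] := linear_opP linD; have [_ _ MZ' M0'] := linear_opP linM'.
have [_ _ _ B0'] := linear_opP linB'; have [_ _ _ T0] := linear_opP linT.
have : adjoint_pair (aluthge M) (S \o (D \o M') \o S).
  rewrite /aluthge -/T -/S polar_factorE.
  have -> : S \o (D \o M') \o S = S \o ((D \o M') \o S) by [].
  apply: adjoint_pair_comp Spair.
  apply: adjoint_pair_comp; first exact: Spair.
  exact: adjoint_pair_comp.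
move=> /adjointE ->; apply/seteqP; split=> f; rewrite /ker_op/=.
  move=> /(congr1 (fun g => B' (T (E g)))).
  rewrite ES TD E0 T0 B0' B'M' => /eqP; rewrite subr_eq0 => /eqP Sf.
  by exists (inner (S f) e0 / s); rewrite -[LHS]ES [in LHS]Sf EZ Ee0 scalerA.
by move=> [c ->]; rewrite SZ Se0 !MZ' M'e0 !scaler0 D0 S0.
Qed.

Variables (a0 : R[i]) (k : R[i] -> H).
Hypotheses (a0_neq0 : a0 != 0).
(* The relation dual to: w (B f)(w) = f(w) - f(0). *)
Hypothesis B'k : forall w, disc w ->
  Num.conj w *: B' (k w) = k w - Num.conj a0 *: e0.

(** The value of (I - conj w L')^-1 at e0; it is found by transporting the
    relation on k w by E, as L' E = E B'. *)
Let v w : H := (s / Num.conj a0) *: E (k w).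

Let resolvent_v w : disc w -> v w - Num.conj w *: (E \o (B' \o S)) (v w) = e0.
Proof.
move=> dw.
have [_ SB SZ _] := linear_opP linS; have [_ EB EZ _] := linear_opP linE.
have [_ _ BZ' _] := linear_opP linB'.
rewrite /= /v SZ BZ' EZ SE scalerA [_ * (s / _)]mulrC.
rewrite -(scalerA (s / Num.conj a0) (Num.conj w)) -(EZ (Num.conj w)) B'k//.
rewrite EB EZ Ee0 -scalerBr.
rewrite opprB addrC subrK !scalerA (_ : _ * s^-1 = 1) ?scale1r//.
by field; rewrite gt_eqF//= conjC_eq0.
Qed.

Let projE x : orthogonal_projection (ker_op (adjoint (aluthge M))) x =
  inner x e0 *: e0.
Proof.
rewrite aluthge_wanderingE; set W := [set f | _].
have [[c Pc] Px] : W (orthogonal_projection W x) /\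
    forall g, W g -> inner (x - orthogonal_projection W x) g = 0.
  apply: (@xgetI _ _ [set P : H -> H | forall f, W (P f) /\
    forall g, W g -> inner (f - P f) g = 0] (fun f => inner f e0 *: e0)) => f.
  split; first by exists (inner f e0).
  move=> _ [c ->]; rewrite innerZr innerBl innerZl e0_norm mulr1 subrr.
  by rewrite mulr0.
have := Px e0; rewrite Pc innerBl innerZl e0_norm mulr1 => xc.
have /eqP : inner x e0 - c = 0 by apply: xc; exists 1; rewrite scale1r.
by rewrite subr_eq0 => /eqP ->.
Qed.

(** The projection of x = (I - z L)^-1 (v w) onto e0 is read off by moving
    I - z L to the other side: <x, e0> = <(I - z L) x, v z> = <v w, v z>. *)
Lemma aluthge_kernelE : exists2 e : R, 0 < e & forall z w,
  disc z -> disc w -> Normc.normc z < e -> Normc.normc w < e ->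
  forall f, ker_op (adjoint (aluthge M)) f ->
  (orthogonal_projection (ker_op (adjoint (aluthge M))) \o
   inverse_op (fun f => f - z *: L f) \o
   inverse_op (fun f => f - Num.conj w *: adjoint L f)) f =
  (t / (a0 * Num.conj a0) * inner (inverse_op (abs_op M) (k w)) (k z)) *: f.
Proof.
have [bL bL' LA] := Lpair.
have [linL [K1 K10 LK1]] := (bounded_operatorP _).1 bL.
have [linL' [K2 K20 LK2]] := (bounded_operatorP _).1 bL'.
(* On the disc of radius 1 / K both resolvents exist. *)
pose K := K1 + K2; have K0 : 0 < K by rewrite addr_gt0.
have [d Kd] : exists d, K = d%:C by apply/complex_realP/ger0_real/ltW.
have d0 : 0 < d by move: K0; rewrite Kd ltcR.
exists d^-1; first by rewrite invr_gt0.
have small x : Normc.normc x < d^-1 -> `|x| * K < 1.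
  move=> xd; rewrite -ltr_pdivlMr// mul1r Kd.
  by rewrite -[`|x|]/((Normc.normc x)%:C) -fmorphV ltcR.
have res (x : R[i]) (F : H -> H) : linear F -> (forall f, `|F f| <= K * `|f|) ->
    Normc.normc x < d^-1 ->
    bounded_inverse (fun f => f - x *: F f)
      (inverse_op (fun f => f - x *: F f)).
  move=> lF FK /small xK.
  have [FD _ FZ _] := linear_opP lF.
  have [||||N NP] := @neumann_inverse _ _ (fun f => x *: F f) (`|x| * K).
  - by move=> c f g; rewrite FD FZ scalerDr !scalerA (mulrC x).
  - by rewrite mulr_ge0// ltW.
  - exact: xK.
  - by move=> f; rewrite normrZ -mulrA ler_wpM2l // FK.
  - by rewrite (inverse_opE NP).
move=> z w dz dw zd wd f; rewrite aluthge_wanderingE => -[c ->].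
rewrite (adjointE Lpair) /= -/E -/S.
have wd' : Normc.normc (Num.conj w) < d^-1.
  suff -> : Normc.normc (Num.conj w) = Normc.normc w by [].
  by apply: complexI; exact: (norm_conjC w).
have [|_ N1 _] := res z L linL _ zd.
  by move=> g; apply: le_trans (LK1 g) _; rewrite ler_wpM2r// lerDl ltW.
have [|_ _ N2] := res (Num.conj w) _ linL' _ wd'.
  by move=> g; apply: le_trans (LK2 g) _; rewrite ler_wpM2r// lerDr ltW.
have [_ _ LZ' _] := linear_opP linL'.
have -> : inverse_op (fun f => f - Num.conj w *: (E \o (B' \o S)) f) (c *: e0) =
    c *: v w.
  rewrite -[RHS](congr1 (fun F => F (c *: v w)) N2) /=; congr inverse_op.
  rewrite -[E _]/((E \o (B' \o S)) (c *: v w)) LZ'.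
  rewrite -{1}(resolvent_v dw) scalerBr (scalerA c (Num.conj w)) (mulrC c).
  by rewrite -scalerA.
set x := inverse_op _ _; have xE : x - z *: L x = c *: v w.
  by rewrite -[RHS](congr1 (fun F => F (c *: v w)) N1).
rewrite -aluthge_wanderingE projE -{1}(resolvent_v dz) innerBr.
rewrite (innerZr (Num.conj z)) conjCK -LA -(innerZl z) -innerBl.
rewrite xE innerZl /v innerZl innerZr inverse_absE scalerA; congr (_ *: _).
have [_ _ EA] := Epair; rewrite -EA -DE mulrC; congr (_ * c).
have sC : Num.conj s = s by rewrite geC0_conj// ltW.
have -> : t = s * s by rewrite -expr2 sqrtCK.
rewrite rmorphM/= fmorphV/= conjCK sC; field.
by rewrite fmorph_eq0 a0_neq0.
Qed.

End AluthgeOfShift.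

(** * Truncated spaces *)

Section Disc.
Variable R : realType.

Lemma discE (z : R[i]) : disc z <-> `|z| < 1.
Proof. by rewrite -[`|z|]/((Normc.normc z)%:C) ltcR. Qed.

Lemma disc0 : disc (0 : R[i]).
Proof. by apply/discE; rewrite normr0. Qed.

(** Division by z determines a function off the origin only; continuity supplies
    the value there. *)
Lemma analytic_eq0_at0 (f : R[i] -> R[i]) : analytic_on_disc f ->
  (forall z, disc z -> z != 0 -> f z = 0) -> f 0 = 0.
Proof.
move=> fa f0; apply/eqP; apply/negPn/negP => f00.
have : {for 0, continuous (f : R[i]^o -> R[i]^o)}.
  by apply/differentiable_continuous/derivable1_diffP/fa/disc0.
move=> /cvgrPdist_lt/(_ `|f 0|); rewrite normr_gt0 => /(_ f00).
move=> /nbhs_ballP[d /= d0 df].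
have [x dx] : exists x, d = x%:C by apply/complex_realP/ger0_real/ltW.
have x0 : 0 < x by rewrite dx ltcR in d0.
pose y := Num.min x 1 / 2; have y0 : 0 < y by rewrite divr_gt0// lt_min x0/=.
have yx : y < x.
  by rewrite ltr_pdivrMr// gt_min ltr_pMr// ltr1n.
have y1 : y < 1.
  by rewrite ltr_pdivrMr// gt_min mul1r ltr1n orbT.
have ny : `|y%:C| = y%:C by rewrite ger0_norm// ler0c ltW.
have : `|f 0 - f y%:C| < `|f 0|.
  by apply: df; rewrite -ball_normE/= sub0r normrN ny dx ltcR.
rewrite (f0 y%:C) ?subr0 ?ltxx//; first by apply/discE; rewrite ny ltcR.
by rewrite gt_eqF// ltcR.
Qed.

End Disc.

Section Expansions.
Variable R : realType.

(** Bounded linear maps act on expansions coefficientwise.  The second domain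
    and radius allow the identity G = phi o F to hold only near the origin. *)
Lemma has_expansion_linear (V W : normedModType R[i]) (Omega Omega' : set R[i])
    (e e' : R) (F : R[i] -> R[i] -> V) (G : R[i] -> R[i] -> W)
    (c : nat -> nat -> V) (phi : V -> W) (K : R[i]) :
  linear phi -> 0 < K -> (forall x, `|phi x| <= K * `|x|) ->
  (forall z, Omega' z -> Normc.normc z < e' -> Omega z /\ Normc.normc z < e) ->
  (forall z w, Omega' z -> Omega' w ->
     Normc.normc z < e' -> Normc.normc w < e' -> G z w = phi (F z w)) ->
  has_expansion Omega e F c ->
  has_expansion Omega' e' G (fun m n => phi (c m n)).
Proof.
move=> lphi K0 phiK sub GE FE z w Oz Ow ze we.
pose phi' : {linear V -> W} :=
  HB.pack phi (GRing.isLinear.Build _ _ _ _ phi lphi).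
have [Oz' ze'] := sub _ Oz ze; have [Ow' we'] := sub _ Ow we.
have [[A Ab] Flim] := FE z w Oz' Ow' ze' we'; split.
  exists (K * A) => N; apply: (@le_trans _ _ (K * \sum_(m < N) \sum_(n < N)
      `|z ^+ m * Num.conj w ^+ n *: c m n|)).
    rewrite mulr_sumr; apply: ler_sum => m _; rewrite mulr_sumr.
    by apply: ler_sum => n _; rewrite -[phi _]/(phi' _) -linearZ; exact: phiK.
  by rewrite ler_pM2l.
have cphi : continuous phi := linear_bound_continuous lphi K0 phiK.
rewrite GE//.
rewrite (_ : (fun N => _) = phi \o
  (fun N => \sum_(m < N) \sum_(n < N) (z ^+ m * Num.conj w ^+ n) *: c m n)).
  by apply: continuous_cvg; [exact: cphi|exact: Flim].
apply/funext => N /=; rewrite -[phi _]/(phi' _) linear_sum.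
apply: eq_bigr => m _.
by rewrite linear_sum; apply: eq_bigr => n _; rewrite linearZ.
Qed.

End Expansions.

Section Evaluation.
Variables (R : realType) (k : R[i] -> R[i] -> R[i]) (H : rkhs k).
Implicit Types (f g : H) (z w : R[i]).

Lemma ev_inner w f : disc w -> ev f w = inner f (kernel_vector H w).
Proof.
move=> dw; have [kw [kwE kwR]] := ev_reproducing H dw.
suff -> : kernel_vector H w = kw by [].
apply: ev_inj => z dz; rewrite kwE//.
exact: (@xgetI _ 0 [set f : H | forall z, disc z -> ev f z = k z w]
  kw kwE z dz).
Qed.

Lemma shift_opE (M : H -> H) :
  (forall f z, disc z -> ev (M f) z = z * ev f z) -> shift_op H = M.
Proof.
move=> ME; apply/funext => f; apply: ev_inj => z dz; rewrite ME//.
exact: (@xgetI _ 0 [set g : H | forall w, disc w -> ev g w = w * ev f w] (M f)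
  (ME f)).
Qed.

End Evaluation.

Section Tridiagonal.
Variables (R : realType) (k : R[i] -> R[i] -> R[i]) (H : rkhs k).

(** The identities are checked on the basis f_n, then extended by totality of
    the basis.  The eigenvector property comes out of B' e0 being a multiple of
    f_1: then M e0 is a multiple of B' e0, and M' B' = I. *)
Lemma truncated_backward_shift (r : nat) : truncated_space H r ->
  exists M M' B B' (e0 : H) (a0 t : R[i]),
  [/\ [/\ adjoint_pair M M', adjoint_pair B B',
     forall f z, disc z -> ev (M f) z = z * ev f z,
     forall f, B (M f) = f &
     forall f, M (B f) = f - inner f e0 *: e0] /\
    [/\ inner e0 e0 = 1, B e0 = 0, 0 < t & M' (M e0) = t ^+ 2 *: e0],
     a0 != 0 &
     forall w, disc w -> Num.conj w *: B' (kernel_vector H w) =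
       kernel_vector H w - Num.conj a0 *: e0].
Proof.
move=> [a [b [[[polyH anH] a0 [[C Ca] [d d0 da]] _ [e eb ev_e]] b0]]].
pose K w := kernel_vector H w.
have evK w f : disc w -> ev f w = inner f (K w) by exact: ev_inner.
pose pol p : H := projT1 (cid (polyH p)).
have ev_pol p z : disc z -> ev (pol p) z = p.[z].
  by rewrite /pol; case: cid => f /= fp dz; exact: fp.
have b_big n : (r < n)%N -> b n = 0.
  by move=> rn; apply: b0; rewrite negb_and -!ltnNge rn orbT.
have b00 : b 0%N = 0 by apply: b0.
have b10 : b 1%N = 0 by apply: b0.
have b1 m : b (r.+1 + m)%N = 0 by apply: b_big; apply: ltn_addr.
have b2 m : b (r.+2 + m)%N = 0 by apply: b_big; apply: ltn_addr; apply: ltnW.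
(* Beyond r, M f_n = (a_n / a_(n+1)) f_(n+1). *)
pose wM n := a (r.+1 + n)%N / a (r.+1 + n).+1.
have wMC n : `|wM n| <= C%:C by rewrite -[`|_|]/((Normc.normc _)%:C) lecR Ca.
have [M [M' [MM' Msmall Mbig]]] := operator_on_basis r.+1 r.+2
  (fun n => pol ((a n)%:P * 'X^(n.+1) + (b n)%:P * 'X^(n.+2))) eb wMC.
have ev_Me n z : disc z -> ev (M (e n)) z = z * ev (e n) z.
  move=> dz; have [nr|] := ltnP n r.+1.
    rewrite Msmall// ev_pol// ev_e// hornerD !hornerCM !hornerXn ?exprS; ring.
  move=> /subnKC <-; rewrite Mbig evK// innerZl -evK// !ev_e//.
  rewrite b1 b2 !mul0r !addr0.
  by rewrite /wM !addSn exprS mulrA divfK// mulrCA.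
have M'K z : disc z -> M' (K z) = Num.conj z *: K z.
  have [_ _ ME] := MM'; move=> dz; apply: (basis_ext eb) => n.
  by rewrite -ME -evK// ev_Me// innerZr conjCK -evK.
have ev_M f z : disc z -> ev (M f) z = z * ev f z.
  have [_ _ ME] := MM'; move=> dz.
  by rewrite evK// ME M'K// innerZr conjCK -evK.
(* Beyond r + 1, B f_n = (a_n / a_(n-1)) f_(n-1): here both f_n and f_(n-1) must
   be monomials, whence the cut at r + 2. *)
pose wB n := a (r.+1 + n).+1 / a (r.+1 + n)%N.
have wBC n : `|wB n| <= (d^-1)%:C.
  rewrite -[wB n]invrK /wB invf_div normfV -[`|_|]/((Normc.normc _)%:C).
  have dn : 0 < Normc.normc (a (r.+1 + n)%N / a (r.+1 + n).+1).
    exact: lt_le_trans (da _).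
  by rewrite -fmorphV lecR lef_pV2// posrE.
have [B [B' [BB' Bsmall Bbig]]] := operator_on_basis r.+2 r.+1
  (fun n => pol (if n is n'.+1 then (a n)%:P * 'X^n' + (b n)%:P * 'X^n else 0))
  eb wBC.
have ev_Be0 z : disc z -> ev (B (e 0%N)) z = 0.
  by move=> dz; rewrite Bsmall// ev_pol// horner0.
have ev_Be n z : disc z -> ev (B (e n.+1)) z = (a n.+1 + b n.+1 * z) * z ^+ n.
  move=> dz; have [nr|] := ltnP n.+1 r.+2.
    rewrite Bsmall// ev_pol// hornerD !hornerCM !hornerXn ?exprS; ring.
  move=> /subnKC nE; rewrite -nE Bbig evK// innerZl -evK// !ev_e//.
  rewrite b1 b2 !mul0r !addr0.
  move: nE; rewrite addSn => -[nE]; rewrite /wB mulrA divfK// nE//.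
have B'K w : disc w -> Num.conj w *: B' (K w) = K w - Num.conj (a 0%N) *: e 0%N.
  have [_ _ BE] := BB'; move=> dw; apply: (basis_ext eb) => n.
  rewrite innerZr conjCK -BE -evK// innerBr innerZr conjCK -evK// eb.1 ev_e//.
  case: n => [|n]; first by rewrite ev_Be0// b00 expr0 eqxx/=; ring.
  by rewrite ev_Be// mulr0 subr0 exprS; ring.
have ev_B f z : disc z -> z * ev (B f) z = ev f z - inner f (e 0%N) * a 0%N.
  have [_ _ BE] := BB'; move=> dz.
  rewrite (evK z (B f))// BE -{1}[z]conjCK -innerZr B'K// innerBr innerZr.
  by rewrite conjCK -evK// mulrC.
have MB f : M (B f) = f - inner f (e 0%N) *: e 0%N.
  apply: ev_inj => z dz; rewrite ev_M// ev_B// [RHS]evK// innerBl innerZl.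
  by rewrite -!evK// ev_e// b00 mul0r addr0 mulr1.
have [[linM _] _ _] := MM'; have [_ MBl _ M0] := linear_opP linM.
(* B M = I follows from M B M = M, as M is injective. *)
have Minj f : M f = 0 -> f = 0.
  move=> Mf; have ev0 z : disc z -> z != 0 -> ev f z = 0.
    move=> dz z0; apply: (mulfI z0); rewrite -ev_M// Mf mulr0.
    by rewrite evK// inner0l.
  apply: ev_inj => z dz; rewrite [RHS]evK// inner0l.
  have [->|] := eqVneq z 0; first exact: analytic_eq0_at0 (anH f) ev0.
  exact: ev0.
have K0 : K 0 = Num.conj (a 0%N) *: e 0%N.
  have := B'K 0 (disc0 R); rewrite conjC0 scale0r => /esym/eqP.
  by rewrite subr_eq0 => /eqP.
have BM f : B (M f) = f.
  apply/eqP; rewrite -subr_eq0; apply/eqP/Minj; rewrite MBl MB.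
  have : inner (M f) (K 0) = 0 by rewrite -evK ?ev_M ?mul0r//; exact: disc0.
  rewrite K0 innerZr conjCK => /eqP; rewrite mulf_eq0 (negbTE (a0 _)).
  by move=> /eqP ->; rewrite scale0r subr0 subrr.
have Be0 : B (e 0%N) = 0.
  by apply: ev_inj => z dz; rewrite ev_Be0// evK// inner0l.
have B'e0 : B' (e 0%N) = Num.conj (a 1%N / a 0%N) *: e 1%N.
  have [_ _ BE] := BB'; apply: (basis_ext eb) => n.
  rewrite -BE innerZr conjCK eb.1; apply: (mulfI (a0 0%N)).
  rewrite -{1}[a 0%N]conjCK -innerZr -K0 -(evK _ _ (disc0 R)).
  case: n => [|[|n]]; first by rewrite (ev_Be0 _ (disc0 R)) !mulr0.
    by rewrite (ev_Be _ _ (disc0 R)) b10 mul0r addr0 !mulr1 mulrC divfK.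
  by rewrite (ev_Be _ _ (disc0 R)) exprS mul0r !mulr0.
have Me0 : M (e 0%N) = (a 0%N / a 1%N) *: e 1%N.
  apply: ev_inj => z dz; rewrite ev_M// [RHS]evK// innerZl -evK// !ev_e//.
  by rewrite b00 b10 !mul0r !addr0 expr0 expr1 mulr1 mulrA divfK// mulrC.
pose t := `|a 0%N / a 1%N|.
exists M, M', B, B', (e 0%N), (a 0%N), t; split=> //; split; first by split.
split=> //; first by rewrite eb.1.
  by rewrite normr_gt0 mulf_neq0// invr_eq0.
have M'B' f : M' (B' f) = f.
  have [_ _ ME] := MM'; have [_ _ BE] := BB'.
  by apply: inner_extr => g; rewrite -ME -BE BM.
have -> : M (e 0%N) = t ^+ 2 *: B' (e 0%N).
  rewrite Me0 B'e0 scalerA /t normCK -mulrA -rmorphM/= mulrA.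
  by rewrite divfK// divff// conjC1 mulr1.
have [_ [linM' _] _] := MM'; have [_ _ MZ' _] := linear_opP linM'.
by rewrite MZ' M'B'.
Qed.

End Tridiagonal.

(** Specialises [aluthge_kernelE] with C = t / |a_0|^2. *)
Lemma truncated_kernels_proportional (R : realType) (k : R[i] -> R[i] -> R[i])
    (H : rkhs k) (r : nat) : truncated_space H r ->
  exists (e0 : H) (C : R[i]) (e : R),
  [/\ inner e0 e0 = 1, aluthge_wandering_subspace H e0, C != 0, 0 < e &
  forall z w, disc z -> disc w -> Normc.normc z < e -> Normc.normc w < e ->
  forall f, aluthge_wandering_subspace H f ->
  shimorin_aluthge_kernel H z w f =
    (C * standard_aluthge_kernel H z w) *: f].
Proof.
move=> /truncated_backward_shift[M [M' [B [B' [e0 [a0 [t]]]]]]].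
move=> [[[MM' BB' ev_M BM MB] [e0n Be0 t0 M'Me0]] a00 B'K].
have [e e_gt0 ke] := aluthge_kernelE MM' BB' BM MB e0n Be0 t0 M'Me0 a00 B'K.
have WE := aluthge_wanderingE MM' BB' BM MB e0n Be0 t0 M'Me0.
have ME : shift_op H = M := shift_opE ev_M.
exists e0, (t / (a0 * Num.conj a0)), e; split=> //.
- by rewrite /aluthge_wandering_subspace ME WE; exists 1; rewrite scale1r.
- by rewrite mulf_neq0 ?invr_eq0 ?mulf_neq0 ?conjC_eq0// gt_eqF.
- move=> z w dz dw ze we f.
  rewrite /aluthge_wandering_subspace /shimorin_aluthge_kernel.
  rewrite /standard_aluthge_kernel /aluthge_left_inverse.
  rewrite /aluthge_wandering_subspace ME; exact: ke.
Qed.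

(** * The two kernels are tridiagonal together *)

Theorem corollary8p4 (R : realType) (k : R[i] -> R[i] -> R[i])
    (hk : positive_definite_kernel k)
    (hka : forall w, disc w -> analytic_on_disc (fun z => k z w))
    (H : rkhs k) (r : nat) (hr : (2 <= r)%N) (hH : truncated_space H r) :
  tridiagonal_operator_kernel (aluthge_wandering_subspace H)
    (shimorin_aluthge_domain H) (shimorin_aluthge_kernel H)
  <-> tridiagonal_kernel disc (standard_aluthge_kernel H).
Proof.
have [e0 [C [eps [e0n We0 C0 eps0 kE]]]] := truncated_kernels_proportional hH.
set W := aluthge_wandering_subspace H in We0 kE *.
split=> [[e [c [e_gt0 cE c0]]]|[e [c [e_gt0 cE c0]]]].
(* The radius 1 / rho keeps z in the domain of the Shimorin-Aluthge kernel,
   whatever the spectral radius is. *)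
- pose rho := `|spectral_radius (aluthge_left_inverse H)| + 1.
  have rho0 : 0 < rho by rewrite ltr_wpDl.
  pose phi (x : H) : R[i]^o := C^-1 * inner x e0.
  exists (Num.min (Num.min e eps) rho^-1), (fun m n => phi (c m n e0)).
  split; first by rewrite !lt_min e_gt0 eps0 invr_gt0.
  + apply: (@has_expansion_linear _ _ _ _ _ _ _ _ _ _ phi (`|C^-1| * `|e0| + 1)
      _ _ _ _ _ (cE e0 We0)).
    * move=> a x y; rewrite /phi innerDl innerZl mulrDr mulrCA; exact: erefl.
    * by rewrite ltr_wpDl// mulr_ge0.
    * move=> x; rewrite normrM mulrDl mul1r -[leLHS]addr0 lerD//.
      by rewrite -mulrA ler_wpM2l// mulrC cauchy_schwarz.
    * move=> z dz; rewrite !lt_min => /andP[/andP[ze _] zr]; split=> //.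
      rewrite /shimorin_aluthge_domain/=.
      apply: (@le_lt_trans _ _ (Normc.normc z * rho)).
        rewrite ler_wpM2l//; first by rewrite -ler0c; exact: (normr_ge0 z).
        by rewrite (le_trans (ler_norm _))// lerDl.
      by rewrite -ltr_pdivlMr// mul1r.
    * move=> z w dz dw; rewrite !lt_min.
      move=> /andP[/andP[_ ze] _] /andP[/andP[_ we] _].
      by rewrite /phi kE// innerZl e0n mulr1 mulrA mulVf// mul1r.
  + by move=> m n mn; rewrite /phi c0// inner0l mulr0.
- exists (Num.min (Num.min e eps) 1), (fun m n f => (C * c m n) *: f).
  split; first by rewrite !lt_min e_gt0 eps0 ltr01.
  + move=> f Wf; apply: (@has_expansion_linear _ _ _ _ _ _ _ _ _ _
      (fun x : R[i]^o => (C * x) *: f) (`|C| * `|f| + 1) _ _ _ _ _ cE).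
    * by move=> a x y; rewrite mulrDr scalerDl scalerA mulrCA.
    * by rewrite ltr_wpDl// mulr_ge0.
    * move=> x; rewrite normrZ normrM mulrDl mul1r -[leLHS]addr0 lerD//.
      by rewrite mulrAC.
    * move=> z _; rewrite !lt_min => /andP[/andP[ze _] z1]; split=> //.
    * move=> z w _ _; rewrite !lt_min.
      move=> /andP[/andP[_ ze] z1] /andP[/andP[_ we] w1].
      exact: kE.
  + by move=> m n mn f _; rewrite c0// mulr0 scale0r.
Qed.
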